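(* Let $m\ge2$ and let $M$ be a multiplier operator on $L^2(S^m)$ with sequence of multipliers $\{\eta_k\}_{k\ge 0}$. If $K\in L^2(S^m\times S^m)$ is a kernel with spherical harmonics expansion $$K(x,y)=\sum_{k=0}^{\infty}\sum_{j=1}^{d_k^m}a_{k,j}Y_{k,j}(x)\overline{Y_{k,j}(y)},\qquad x,y\in S^m,$$ then $$\sum_{k=0}^{\infty}|\eta_k-1|^2\sum_{j=1}^{d_k^m}|a_{k,j}|^2=\frac1{\omega_m}\int_{S^m}\|M(K^y)-K^y\|_2^2\,d\sigma_m(y).$$
   Context: $S^m$ is the unit sphere of $\mathbb{R}^{m+1}$ with surface measure $\sigma_m$ and total area $\omega_m=2\pi^{(m+1)/2}/\Gamma((m+1)/2)$. $L^2(S^m)=L^2(S^m,\sigma_m)$ carries the norm $\|f\|_2=\left(\frac1{\omega_m}\int_{S^m}|f|^2\,d\sigma_m\right)^{1/2}$, with inner product $\langle f,g\rangle_2=\frac1{\omega_m}\int_{S^m} f\overline g\,d\sigma_m$; $L^2(S^m\times S^m)=L^2(S^m\times S^m,\sigma_m\times\sigma_m)$. $\mathcal{H}_k^m$ is the space of spherical harmonics of degree $k$ in $m+1$ variables, $d_k^m$ its dimension, and $\{Y_{k,j}:j=1,\dots,d_k^m\}$ a fixed orthonormal basis of $\mathcal{H}_k^m$ with respect to $\langle\cdot,\cdot\rangle_2$. $\mathcal{Y}_k$ is the orthogonal projection of $L^2(S^m)$ onto $\mathcal{H}_k^m$. A multiplier operator on $L^2(S^m)$ is a linear operator $M:L^2(S^m)\to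 L^2(S^m)$ for which there is a sequence $\{\eta_k\}$ of complex numbers (its sequence of multipliers) with $\mathcal{Y}_k(Mf)=\eta_k\mathcal{Y}_k(f)$ for all $f\in L^2(S^m)$ and $k=0,1,2,\dots$. For a kernel $K$ and $y\in S^m$, $K^y$ denotes the function $K^y(x)=K(x,y)$, $x\in S^m$ (an element of $L^2(S^m)$). The expansion of $K$ is understood in the $L^2$ sense. *)

(* Defs.v *)
From HB Require Import structures.
(* Importing mpoly after the analysis files fails (incompatible notations). *)
From mathcomp Require Import mpoly.
From mathcomp Require Import all_boot all_order all_algebra.
From mathcomp Require Import all_classical all_reals all_analysis.
From mathcomp Require Import measurable_realfun complex.

Set Implicit Arguments.
Unset Strict Implicit.
Unset Printing Implicit Defensive.
Import Order.TTheory GRing.Theory Num.Theory.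
Import numFieldNormedType.Exports.

Local Open Scope classical_set_scope.
Local Open Scope ring_scope.
Local Open Scope complex_scope.

Section lebesgue_tuple.
Variable R : realType.

Definition cons_pair n (p : R * n.-tuple R) : n.+1.-tuple R :=
  [the n.+1.-tuple R of p.1 :: p.2].

Lemma measurable_cons_pair n : measurable_fun setT (@cons_pair n).
Proof. exact: measurable_cons. Qed.

Section step.
Variables (n : nat) (mu : {measure set (n.-tuple R) -> \bar R}).

Definition lebesgue_consm (A : set (n.+1.-tuple R)) : \bar R :=
  pushforward (lebesgue_measure \x^ mu)%E (@cons_pair n) A.

Let mf := @measurable_cons_pair n.

Let lebesgue_consm0 : lebesgue_consm set0 = 0%E.
Proof. exact: measure0. Qed.

Let lebesgue_consm_ge0 A : (0 <= lebesgue_consm A)%E.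
Proof. exact: measure_ge0. Qed.

Let lebesgue_consm_sigma_additive : semi_sigma_additive lebesgue_consm.
Proof. exact: measure_semi_sigma_additive. Qed.

HB.instance Definition _ := isMeasure.Build _ _ _ lebesgue_consm
  lebesgue_consm0 lebesgue_consm_ge0 lebesgue_consm_sigma_additive.
End step.

(* Lebesgue measure on R^n, with points represented as n-tuples:
   lambda_0 is the unit mass at the empty tuple, and lambda_(n+1) is the
   product of lambda_1 and lambda_n transported along (t, x) |-> t :: x. *)
Fixpoint lebesgue_tuple n : {measure set (n.-tuple R) -> \bar R} :=
  if n is k.+1 then lebesgue_consm (lebesgue_tuple k)
  else dirac [tuple].

End lebesgue_tuple.

Definition cube (R : realType) n (a b : R) : set (n.-tuple R) :=
  [set x | forall i, tnth x i \in `[a, b]].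
Arguments cube {R} n a b.

Lemma measurable_cube (R : realType) n (a b : R) : measurable (cube n a b).
Proof.
rewrite (_ : cube n a b =
    \bigcap_i ((fun x : n.-tuple R => tnth x i) @^-1` `[a, b])).
  apply: fin_bigcap_measurable => // i _.
  by rewrite -[X in measurable X]setTI; apply: measurable_tnth.
by apply/seteqP; split=> [x xc i _|x xc i]; [exact: xc|exact: (xc i)].
Qed.

Lemma lebesgue_tuple_cube (R : realType) n (a b : R) : a <= b ->
  lebesgue_tuple R n (cube n a b) = ((b - a) ^+ n)%:E.
Proof.
move=> ab; elim: n => [|n IHn].
  rewrite expr0 /= /dirac indicE; case: (boolP (_ \in _)) => // /negP[].
  by rewrite inE => -[].
rewrite /= /lebesgue_consm /pushforward.
rewrite (_ : _ @^-1` _ = `[a, b]%classic `*` cube n a b); last first.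
  apply/seteqP; split=> -[t x] /=.
    move=> tx; split=> [|i]; first exact: (tx ord0).
    by have := tx (lift ord0 i); rewrite tnthS.
  move=> [t1 x1] i; case: (unliftP ord0 i) => [j ->|->]; last exact: t1.
  by rewrite tnthS; exact: x1.
rewrite product_measure2E//; last exact: measurable_cube.
rewrite [X in (_ * X)%E]IHn exprS EFinM; congr (_ * _)%E.
apply: etrans (lebesgue_measure_itv _) _.
rewrite /= lte_fin; case: ltP => [_|ba]; first by rewrite EFinB.
by rewrite (@le_anti _ _ a b) ?subrr// ab.
Qed.

Section sphere.
Variables (R : realType) (m : nat).
Local Notation E := (m.+1.-tuple R).

Definition sqnorm (x : E) : R := \sum_(i < m.+1) tnth x i ^+ 2.

Definition sphere : Type := {x : E | sqnorm x == 1}.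

HB.instance Definition _ := Choice.on sphere.
HB.instance Definition _ := SubType.on sphere.

Let pole_subproof :
  sqnorm [tuple (i == ord0)%:R | i < m.+1] == 1.
Proof.
rewrite /sqnorm big_ord_recl big1 ?tnth_mktuple ?expr1n ?addr0// => i _.
by rewrite tnth_mktuple expr0n.
Qed.

Definition pole : sphere := Sub [tuple (i == ord0)%:R | i < m.+1] pole_subproof.

HB.instance Definition _ := isPointed.Build sphere pole.

(* Borel sets of the sphere: traces of the Borel sets of R^(m+1) *)
Definition sphere_measurable : set (set sphere) :=
  preimage_set_system setT (val : sphere -> E) measurable.

Let sphere_sigma : sigma_algebra setT sphere_measurable.
Proof. exact/sigma_algebra_preimage/sigma_algebra_measurable. Qed.

Let sphere_measurable0 : sphere_measurable set0.
Proof. by case: sphere_sigma. Qed.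

Let sphere_measurableC A :
  sphere_measurable A -> sphere_measurable (~` A).
Proof. by case: sphere_sigma => _ + _ => /[apply]; rewrite setTD. Qed.

Let sphere_measurable_bigcup (F : (set sphere)^nat) :
  (forall i, sphere_measurable (F i)) -> sphere_measurable (\bigcup_i (F i)).
Proof. by case: sphere_sigma => _ _; apply. Qed.

HB.instance Definition _ := @isMeasurable.Build
  (measure_tuple_display default_measure_display) sphere
  sphere_measurable sphere_measurable0 sphere_measurableC
  sphere_measurable_bigcup.

(* radial projection x |-> x / |x|; the value at the origin is irrelevant *)
Definition radial (x : E) : sphere :=
  insubd pole [tuple tnth x i / Num.sqrt (sqnorm x) | i < m.+1].

Definition punctured_ball : set E := [set x | 0 < sqnorm x <= 1].

Lemma measurable_sqnorm : measurable_fun setT sqnorm.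
Proof.
apply: measurable_sum => i.
by apply: measurable_funX; exact: measurable_tnth.
Qed.

Lemma measurable_punctured_ball : measurable punctured_ball.
Proof.
rewrite (_ : punctured_ball = sqnorm @^-1` `]0, 1]).
  by rewrite -[X in measurable X]setTI; exact: measurable_sqnorm.
by apply/seteqP; split => x; rewrite /= in_itv.
Qed.

Lemma measurable_radial : measurable_fun setT radial.
Proof.
pose g (x : E) := [tuple tnth x i / Num.sqrt (sqnorm x) | i < m.+1].
have mg : measurable_fun setT g.
  apply/measurable_fun_tnthP => i.
  rewrite (_ : _ \o _ = fun x => tnth x i * (sqnorm x `^ (- 2^-1))%R);
      last first.
    apply/funext => x /=; rewrite tnth_mktuple powRN powR12_sqrt//.
    by rewrite sumr_ge0// => j _; exact: sqr_ge0.
  apply: measurable_funM; first exact: measurable_tnth.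
  by apply: (measurableT_comp (measurable_powR _)); exact: measurable_sqnorm.
have mr : measurable_fun setT (fun x => val (radial x)).
  rewrite (_ : (fun x => _) =
      fun x => if sqnorm (g x) == 1 then g x else val pole); last first.
    by apply/funext => x; rewrite /radial val_insubd.
  apply: measurable_fun_ifT => //.
  apply: measurable_fun_eqr; last exact: measurable_cst.
  by apply: measurableT_comp => //; exact: measurable_sqnorm.
move=> _ _ [B mB <-]; rewrite setTI.
by have := mr measurableT _ mB; rewrite !setTI.
Qed.

Lemma lebesgue_tuple_punctured_ball :
  (0 < lebesgue_tuple R m.+1 punctured_ball < +oo)%E.
Proof.
apply/andP; split.
  pose e : R := (m.+1%:R * 2)^-1.
  have e0 : 0 < e by rewrite invr_gt0 mulr_gt0.
  have e2 : e <= e *+ 2 by rewrite mulr2n lerDl ltW.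
  apply: (@lt_le_trans _ _ (lebesgue_tuple R m.+1 (cube m.+1 e (e *+ 2)))).
    by rewrite lebesgue_tuple_cube// lte_fin exprn_gt0// mulr2n addrK.
  apply: le_measure.
  - by rewrite inE; exact: measurable_cube.
  - by rewrite inE; exact: measurable_punctured_ball.
  move=> x xe; apply/andP; split.
    rewrite /sqnorm (bigD1 ord0)//= ltr_pwDl//.
      by rewrite exprn_gt0// (lt_le_trans e0)//; have /itvP-> := xe ord0.
    by rewrite sumr_ge0// => j _; exact: sqr_ge0.
  apply: (@le_trans _ _ (\sum_(i < m.+1) (e *+ 2) ^+ 2)).
    apply: ler_sum => i _.
    have ex : 0 <= tnth x i.
      by rewrite (le_trans (ltW e0))//; have /itvP-> := xe i.
    by rewrite lerXn2r ?nnegrE// ?mulrn_wge0 ?(ltW e0)//; have /itvP-> := xe i.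
  have m0 : (m.+1%:R : R) != 0 by rewrite pnatr_eq0.
  rewrite sumr_const card_ord (_ : e *+ 2 = m.+1%:R^-1); last first.
    by rewrite -(mulr_natr e) /e invfM mulfVK// pnatr_eq0.
  by rewrite expr2 -[leLHS]mulr_natr mulfVK// invf_le1 ?ltr0n// ler1n.
apply: (@le_lt_trans _ _ (lebesgue_tuple R m.+1 (cube m.+1 (- 1) 1)));
    last first.
  by rewrite lebesgue_tuple_cube ?ltry// gerN.
apply: le_measure.
- by rewrite inE; exact: measurable_punctured_ball.
- by rewrite inE; exact: measurable_cube.
move=> x /andP[_ x1] i; rewrite in_itv/= -ler_norml -(@expr_le1 _ 2)//.
rewrite real_normK ?num_real//; apply: le_trans x1.
by rewrite /sqnorm (bigD1 i)//= lerDl sumr_ge0// => j _; exact: sqr_ge0.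
Qed.

(* Surface measure of the unit sphere of R^n with n = m + 1: n times the
   Lebesgue measure of the cone {t x | x in A, 0 < t <= 1} over A. *)
Definition surface_measure (A : set sphere) : \bar R :=
  (m.+1%:R%:E * lebesgue_tuple R m.+1 (radial @^-1` A `&` punctured_ball))%E.

Let mr := measurable_radial.

Let cone : set sphere -> \bar R :=
  pushforward (mrestr (lebesgue_tuple R m.+1) measurable_punctured_ball) radial.

Let surface_measure0 : surface_measure set0 = 0%E.
Proof. by rewrite /surface_measure preimage_set0 set0I measure0 mule0. Qed.

Let surface_measure_ge0 A : (0 <= surface_measure A)%E.
Proof. by apply: mule_ge0 => //; exact: measure_ge0. Qed.

Let surface_measure_sigma_additive : semi_sigma_additive surface_measure.
Proof.
move=> F mF tF mUF; rewrite [X in X @ _ --> _](_ : _ =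
    (fun n => m.+1%:R%:E * \sum_(0 <= i < n) cone (F i)))%E; last first.
  by apply/funext => n; rewrite ge0_sume_distrr// => i _; exact: measure_ge0.
apply: cvgeZl => //; rewrite -[X in _ --> X]/(cone (\bigcup_n F n)).
exact: measure_semi_sigma_additive.
Qed.

HB.instance Definition _ := isMeasure.Build _ _ _ surface_measure
  surface_measure0 surface_measure_ge0 surface_measure_sigma_additive.

Let surface_measure_fin : fin_num_fun surface_measure.
Proof.
apply: lty_fin_num_fun.
rewrite /= /surface_measure preimage_setT setTI.
by apply: lte_mul_pinfty => //; have /andP[] := lebesgue_tuple_punctured_ball.
Qed.

HB.instance Definition _ := Measure_isFinite.Build _ _ _ surface_measure
  surface_measure_fin.

(* omega_m = 2 pi^((m+1)/2) / Gamma((m+1)/2) *)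
Definition total_area : R := fine (surface_measure setT).

Lemma total_area_gt0 : 0 < total_area.
Proof.
have fin : (surface_measure setT < +oo)%E.
  exact/fin_num_fun_lty/surface_measure_fin.
rewrite fine_gt0// fin andbT.
rewrite /surface_measure preimage_setT setTI mule_gt0//.
by have /andP[] := lebesgue_tuple_punctured_ball.
Qed.

End sphere.
Arguments surface_measure : clear implicits.

Section complex_L2.
Variable R : realType.
Local Notation C := R[i].

Definition absc (z : C) : R := complex.Re `|z|.

Section measure_space.
Context d (T : measurableType d) (mu : {measure set T -> \bar R}).

(* Elements of L^2(mu; C) are represented by square-integrable functions,
   identified when equal mu-almost everywhere. *)
Definition square_integrable (f : T -> C) : Prop :=
  [/\ measurable_fun setT (fun x => complex.Re (f x)),
      measurable_fun setT (fun x => complex.Im (f x)) &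
      (\int[mu]_x (absc (f x) ^+ 2)%:E < +oo)%E].

Definition cintegral (f : T -> C) : C :=
  Complex (\int[mu]_x complex.Re (f x)) (\int[mu]_x complex.Im (f x)).

Definition ae_equal (f g : T -> C) : Prop := {ae mu, forall x, f x = g x}.

End measure_space.
End complex_L2.

Section harmonics.
Variables (R : realType) (m : nat).
Local Notation C := R[i].
Local Notation S := (sphere R m).
Local Notation sigma := (surface_measure R m).
Local Notation omega := (total_area R m).

Definition inner2 (f g : S -> C) : C :=
  (omega^-1)%:C * cintegral sigma (fun x => f x * (g x)^*).

Definition norm2 (f : S -> C) : \bar R :=
  (((omega^-1)%:E * \int[sigma]_x (absc (f x) ^+ 2)%:E) `^ 2^-1)%E.

Definition laplacian (p : {mpoly C[m.+1]}) : {mpoly C[m.+1]} :=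
  \sum_(i < m.+1) p^`M(i)^`M(i).

Definition harmonic_polynomial k (p : {mpoly C[m.+1]}) : Prop :=
  p \is k.-homog /\ laplacian p = 0.

Definition eval_sphere (p : {mpoly C[m.+1]}) : S -> C :=
  fun x => p.@[fun i => (tnth (val x) i)%:C].

Definition spherical_harmonics k : set (S -> C) :=
  eval_sphere @` [set p | harmonic_polynomial k p].

(* For f in L^2, such a g exists and is unique since H_k is finite
   dimensional, so the default value of xget plays no role. *)
Definition harmonic_proj k (f : S -> C) : S -> C :=
  xget (fun=> 0) [set g | spherical_harmonics k g /\
    forall h, spherical_harmonics k h -> inner2 (f \- g) h = 0].

Definition orthonormal_basis k n (Y : 'I_n -> S -> C) : Prop :=
  [/\ forall j, spherical_harmonics k (Y j),
      forall i j, inner2 (Y i) (Y j) = (i == j)%:R &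
      forall h, spherical_harmonics k h ->
        exists c : 'I_n -> C, h = fun x => \sum_(j < n) c j * Y j x].

Record multiplier_operator (M : (S -> C) -> S -> C) (eta : nat -> C) : Prop := {
  multiplier_L2 : forall f, square_integrable sigma f ->
    square_integrable sigma (M f);
  multiplier_ae : forall f g,
    square_integrable sigma f -> square_integrable sigma g ->
    ae_equal sigma f g -> ae_equal sigma (M f) (M g);
  multiplier_linear : forall (c : C) f g,
    square_integrable sigma f -> square_integrable sigma g ->
    ae_equal sigma (M (fun x => c * f x + g x))
                   (fun x => c * M f x + M g x);
  multiplier_proj : forall f k, square_integrable sigma f ->
    harmonic_proj k (M f) = fun x => eta k * harmonic_proj k f x }.

Definition partial_expansion (d : nat -> nat) (Y : forall k, 'I_(d k) -> S -> C)
    (a : forall k, 'I_(d k) -> C) n (z : S * S) : C :=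
  \sum_(k < n) \sum_(j < d k) a k j * Y k j z.1 * (Y k j z.2)^*.

Definition L2_expansion (d : nat -> nat) (Y : forall k, 'I_(d k) -> S -> C)
    (a : forall k, 'I_(d k) -> C) (K : S * S -> C) : Prop :=
  (\int[sigma \x sigma]_z
     (absc (K z - partial_expansion Y a n z) ^+ 2)%:E)%E @[n --> \oo] --> 0%E.

End harmonics.

(* Main.v *)
From HB Require Import structures.
Require Import Defs.
From mathcomp Require Import mpoly.
From mathcomp Require Import all_boot all_order all_algebra.
From mathcomp Require Import all_classical all_reals all_analysis.
From mathcomp Require Import measurable_realfun complex ring lra zify.

(** The identity is proved slice by slice. Write K^y for x |-> K(x, y). For
    almost every y this slice is square integrable, and its coefficient on
    Y_(k,j) is a_(k,j) times the conjugate of Y_(k,j)(y) ([slice_coef]). The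
    multiplier equation multiplies the k-th coefficients by eta_k
    ([multiplier_coef]), so M(K^y) - K^y has the coefficients of K^y times
    eta_k - 1, and Parseval's identity ([parseval]) gives
      norm2 (M(K^y) - K^y)^2
        = sum_k |eta_k - 1|^2 sum_j |a_(k,j)|^2 |Y_(k,j)(y)|^2
    ([slice_defect]). Integrating over y term by term, with Y_(k,j) of norm
    one, yields the theorem. The left-hand side of this formula need not be
    measurable in y, but the integral of a nonnegative function does not see
    null sets ([ae_eq_integral_ge0]).

    Parseval's identity rests on two facts about spherical harmonics.

    Harmonics of different degrees are orthogonal. Instead of Green's formula on
    the sphere, the proof integrates by parts over the unit ball: the integral
    of the i-th partial derivative of (1 - |x|^2) x^al is zero
    ([ball_integration_by_parts]). In polar coordinates ([polar_integral]) this
    becomes int_S x_i u = kappa(s) int_S d_i u for u homogeneous of degree s,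
    where kappa(s) depends only on s ([poly_integration_by_parts]). For p
    and q harmonic of degrees k and l, Euler's identity then gives
      k int_S p q = kappa(k + l - 1) int_S grad p . grad q,
    whose right-hand side is symmetric in p and q, so (k - l) int_S p q = 0
    ([harmonic_orthogonal]). The polar coordinates come from the scaling of
    Lebesgue measure: under the measure of the ball, radius and direction are
    independent ([ball_measure_polar]).

    The harmonics span a dense subspace. Polynomials are dense in L^2(S^m)
    because explicit polynomials converge boundedly to the indicators of the
    sets where x_i <= b_i for all i, and these sets generate the Borel sets
    ([polynomial_density]). On the sphere each polynomial is a finite sum of
    harmonic ones, because Delta^j (|x|^(2j) u) is a positive multiple of u for
    u harmonic ([harmonic_sum_poly]). *)

Set Implicit Arguments.
Unset Strict Implicit.
Unset Printing Implicit Defensive.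
Import Order.TTheory GRing.Theory Num.Theory.
Import numFieldNormedType.Exports.

Local Open Scope classical_set_scope.
Local Open Scope ring_scope.
Local Open Scope complex_scope.

(** * Fubini and dilations for Lebesgue measure on tuples *)

Section lebesgue_tuple_theory.
Variable R : realType.

(** A name for the bare set function of [lebesgue_tuple], on which the
    sigma-finiteness needed for Fubini's theorem can be declared. *)
Definition tuple_lebesgue n (A : set (n.-tuple R)) : \bar R := lebesgue_tuple R
  n A.

HB.instance Definition _ n := isMeasure.Build _ _ _ (@tuple_lebesgue n)
  (measure0 _) (measure_ge0 _) (@measure_semi_sigma_additive _ _ _
    (lebesgue_tuple R n)).

Lemma tuple_lebesgue_sigma_finite n : sigma_finite setT (@tuple_lebesgue n).
Proof.
exists (fun k => cube n (- k%:R) k%:R)%R.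
  apply/esym/seteqP; split=> // x _.
  have [k xk] : exists k : nat, forall i, (`|tnth x i| <= k%:R)%R.
    pose M := \sum_i `|tnth x i|%R.
    have M0 : (0 <= M)%R by exact: sumr_ge0.
    exists (Num.Def.archi_bound M) => i.
    apply: (@le_trans _ _ M); first by rewrite /M (bigD1 i)//= lerDl sumr_ge0.
    exact/ltW/archi_boundP.
  by exists k => // i; rewrite /= in_itv/= -ler_norml.
move=> k; split; first exact: measurable_cube.
rewrite /tuple_lebesgue lebesgue_tuple_cube ?ltry//.
by rewrite (@le_trans _ _ 0%R) ?oppr_le0.
Qed.

HB.instance Definition _ n := Measure_isSigmaFinite.Build _ _ _
  (@tuple_lebesgue n)
  (@tuple_lebesgue_sigma_finite n).

Lemma tuple_lebesgue_consE n : @tuple_lebesgue n.+1 =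
  pushforward (lebesgue_measure \x^ @tuple_lebesgue n)%E (@cons_pair R n).
Proof. by []. Qed.

Lemma lebesgue_prod_tupleE n A : measurable A ->
  ((lebesgue_measure \x @tuple_lebesgue n) A = (lebesgue_measure \x^
    @tuple_lebesgue n) A)%E.
Proof.
move=> mA; apply: product_measure_unique => // B C mB mC/=.
by rewrite product_measure2E.
Qed.

Lemma ge0_integral_cons n (f : n.+1.-tuple R -> \bar R) :
  measurable_fun setT f -> (forall x, 0 <= f x)%E ->
  (\int[@tuple_lebesgue n.+1]_x f x =
  \int[lebesgue_measure \x @tuple_lebesgue n]_p f (cons_pair p))%E.
Proof.
move=> mf f0; rewrite tuple_lebesgue_consE ge0_integral_pushforward//;
  last first.
  exact: measurable_cons_pair.
by apply/esym/eq_measure_integral => A mA _; exact: lebesgue_prod_tupleE.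
Qed.

Lemma integrable_cons n (f : n.+1.-tuple R -> \bar R) :
  (@tuple_lebesgue n.+1).-integrable setT f ->
  (lebesgue_measure \x @tuple_lebesgue n)%E.-integrable setT (f \o @cons_pair R
    n).
Proof.
move=> /integrableP[mf fy]; apply/integrableP; split.
  by apply: measurableT_comp => //; exact: measurable_cons_pair.
have := @ge0_integral_cons _ (abse \o f) (measurableT_comp (@abse_measurable R
  setT) mf).
by move=> /(_ (fun=> abse_ge0 _)) <-.
Qed.

Lemma integral_cons n (f : n.+1.-tuple R -> \bar R) :
  (@tuple_lebesgue n.+1).-integrable setT f ->
  (\int[@tuple_lebesgue n.+1]_x f x =
  \int[lebesgue_measure \x @tuple_lebesgue n]_p f (cons_pair p))%E.
Proof.
move=> intf; have [mf _] := integrableP _ _ _ intf.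
rewrite integralE [RHS]integralE; congr (_ - _)%E.
  rewrite (funepos_comp f (@cons_pair R n)).
  by apply: ge0_integral_cons => //; exact: measurable_funepos.
rewrite (funeneg_comp f (@cons_pair R n)).
by apply: ge0_integral_cons => //; exact: measurable_funeneg.
Qed.

Lemma integral_cons12 n (f : n.+1.-tuple R -> \bar R) :
  (@tuple_lebesgue n.+1).-integrable setT f ->
  (\int[@tuple_lebesgue n.+1]_x f x =
  \int[lebesgue_measure]_t \int[@tuple_lebesgue n]_x f (cons_pair (t, x)))%E.
Proof.
move=> intf; rewrite integral_cons//.
exact/esym/(integral12_prod_meas1 (integrable_cons intf)).
Qed.

Lemma integral_cons21 n (f : n.+1.-tuple R -> \bar R) :
  (@tuple_lebesgue n.+1).-integrable setT f ->
  (\int[@tuple_lebesgue n.+1]_x f x =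
  \int[@tuple_lebesgue n]_x \int[lebesgue_measure]_t f (cons_pair (t, x)))%E.
Proof.
move=> intf; rewrite integral_cons//.
exact/esym/(integral21_prod_meas1 (integrable_cons intf)).
Qed.

End lebesgue_tuple_theory.

Section dilation.
Variable R : realType.

(** Both sides are measures in A that agree on the half-open intervals. *)
Lemma lebesgue_measure_dilation (r : R) (A : set R) : 0 < r -> measurable A ->
  (lebesgue_measure (( *%R r) @^-1` A) = (r^-1)%:E * lebesgue_measure A)%E.
Proof.
move=> r0 mA.
have mr : measurable_fun setT ( *%R r : measurableTypeR R -> measurableTypeR R).
  exact: measurable_funM.
have rA : (lebesgue_measure A =
    mscale (NngNum (ltW r0))
      (measure_function_pushforward__canonical__measure_function_Measure
        lebesgue_measure mr) A)%E.
  apply: (@lebesgue_measure_unique R (mscale _ _)) => // _ [[a b]] _ <-.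
  pose I : set R := `]a / r, b / r]%classic.
  transitivity (r%:E * lebesgue_measure I)%E; last first.
    congr (_ * lebesgue_measure _)%E.
    apply/seteqP; split => x;
      rewrite /I /= !in_itv/= ltr_pdivrMr// ler_pdivlMr//;
    by rewrite ![_ * r]mulrC.
  rewrite /I !lebesgue_measure_itv/= !lte_fin ltr_pM2r ?invr_gt0//.
  case: ifPn => _; last by rewrite mule0.
  rewrite -!EFinD -EFinM; congr EFin.
  by rewrite -mulrBl mulrCA divff ?mulr1// gt_eqF.
by rewrite [in RHS]rA /mscale/= muleA -EFinM mulVf ?gt_eqF// mul1e.
Qed.

Definition dilation n (r : R) (x : n.-tuple R) : n.-tuple R :=
  [tuple r * tnth x i | i < n].

Lemma dilation_cons n r (p : R * n.-tuple R) :
  dilation r (cons_pair p) = cons_pair (r * p.1, dilation r p.2).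
Proof.
apply: eq_from_tnth => i; rewrite tnth_mktuple.
case: (unliftP ord0 i) => [j ->|->]; last by [].
by rewrite !tnthS tnth_mktuple.
Qed.

Lemma measurable_dilation n r : measurable_fun setT (@dilation n r).
Proof.
apply/measurable_fun_tnthP => i.
rewrite (_ : _ \o _ = fun x : n.-tuple R => r * tnth x i).
  by apply: measurable_funM => //; exact: measurable_tnth.
by apply/funext => x; rewrite /= tnth_mktuple.
Qed.

(** The measure of a set is the integral of the lengths of its sections in the
    first coordinate; the dilation shrinks each section by the factor r and
    permutes the sections by the dilation of the remaining coordinates. *)
Lemma tuple_lebesgue_dilation n (r : R) (A : set (n.-tuple R)) : 0 < r ->
  measurable A ->
  (tuple_lebesgue (@dilation n r @^-1` A) = (r^-1 ^+ n)%:E * tuple_lebesgue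
    A)%E.
Proof.
move=> r0; elim: n A => [|n IHn] A mA.
  rewrite expr0 mul1e; congr (tuple_lebesgue _); apply/seteqP; split => x /=;
  by rewrite !(tuple0 x) (tuple0 (dilation _ _)).
have rn0 : 0 <= r^-1 ^+ n by rewrite exprn_ge0// invr_ge0 ltW.
have mcA : measurable (@cons_pair R n @^-1` A).
  by rewrite -[X in measurable X]setTI; exact: measurable_cons_pair.
pose g x := lebesgue_measure (ysection (@cons_pair R n @^-1` A) x).
have mg : measurable_fun setT g by exact: measurable_fun_ysection.
have g0 x : (0 <= g x)%E by exact: measure_ge0.
have rr0 : (0 <= (r^-1)%:E)%E by rewrite lee_fin invr_ge0 ltW.
transitivity (\int[@tuple_lebesgue R n]_x ((r^-1)%:E * g (dilation r x)))%E.
  rewrite tuple_lebesgue_consE /pushforward /product_measure2;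
    apply: eq_integral => x _.
  rewrite /g /= -lebesgue_measure_dilation//; last exact: measurable_ysection.
  congr (lebesgue_measure _); apply/seteqP; split => t.
    by rewrite /ysection/= !inE /= dilation_cons.
  by rewrite /ysection/= !inE /= dilation_cons.
have mgd : measurable_fun setT (g \o @dilation n r).
  by apply: measurableT_comp => //; exact: measurable_dilation.
rewrite ge0_integralZl//.
rewrite exprS EFinM -muleA; congr (_ * _)%E.
transitivity (\int[pushforward (@tuple_lebesgue R n) (@dilation n r)]_x g x)%E.
  by rewrite (ge0_integral_pushforward (@measurable_dilation n r)).
transitivity (\int[mscale (NngNum rn0) (@tuple_lebesgue R n)]_x g x)%E.
  pose pf := measure_function_pushforward__canonical__measure_function_Measure
    (@tuple_lebesgue R n) (@measurable_dilation n r).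
  apply: (@eq_measure_integral _ _ _ setT (mscale (NngNum rn0) (@tuple_lebesgue
    R n)) pf).
  by move=> B mB _; exact: IHn.
by rewrite ge0_integral_mscale.
Qed.

End dilation.

(** * Integration by parts on balls *)

Section ball_integration_by_parts.
Variable R : realType.

Lemma is_derive_horner (p : {poly R}) (x : R) : is_derive x (1 : R) (horner p)
  p^`().[x].
Proof.
elim/poly_ind: p => [|p c IHp].
  rewrite deriv0 horner0 (_ : horner 0 = cst 0); first exact: is_derive_cst.
  by apply/funext => y; rewrite horner0.
rewrite (_ : horner _ = (fun y => p.[y] * y + c)); last first.
  by apply/funext => y; rewrite !hornerE.
rewrite derivD derivM derivX derivC addr0 mulr1 hornerD hornerM hornerX.
apply: is_derive_eq.
rewrite /GRing.scale/=; ring.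
Qed.

Lemma integral_deriv_poly (p : {poly R}) (a b : R) : a < b ->
  (\int[lebesgue_measure]_(t in `[a, b]) (p^`().[t])%:E = (p.[b] - p.[a])%:E)%E.
Proof.
move=> ab; rewrite (@continuous_FTC2 _ (horner p^`()) (horner p))//.
- by apply: continuous_subspaceT => x; exact: continuous_horner.
- split.
  + by move=> x _; have := is_derive_horner p x; case.
  + by apply: cvg_at_right_filter; exact: continuous_horner.
  + by apply: cvg_at_left_filter; exact: continuous_horner.
- move=> x _; rewrite derive1E; have := is_derive_horner p x.
  by case=> _ ->.
Qed.

(** The integrand is the derivative of k (c - t^2) t^a, which vanishes at both
    ends of the interval t^2 <= c. *)
Lemma integral_ibp_line (k c : R) (a : nat) :
  (\int[lebesgue_measure]_t (((t ^+ 2 <= c)%R)%:R * (k *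
     (a%:R * t ^+ a.-1 * (c - t ^+ 2) - 2 * t * t ^+ a)))%:E = 0)%E.
Proof.
have [c0|c0] := leP c 0.
  rewrite integral0_eq// => t _; have [tc|] := boolP (t ^+ 2 <= c);
    last by rewrite mul0r.
  have t0 : t ^+ 2 = 0 by apply/le_anti; rewrite sqr_ge0 (le_trans tc).
  have ct : c = 0 by apply/le_anti; rewrite c0 -t0.
  by rewrite mul1r ct t0 subrr mulr0 -[2 * t * _]mulrA -exprS -(addn1 a) exprD;
    move/eqP: t0; rewrite sqrf_eq0 => /eqP ->; rewrite expr1 !mulr0 subrr mulr0.
pose s := Num.sqrt c.
have s0 : 0 < s by rewrite sqrtr_gt0.
have s2 : s ^+ 2 = c by rewrite sqr_sqrtr// ltW.
pose p : {poly R} := k%:P * ((c%:P - 'X ^+ 2) * 'X ^+ a).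
have pE t : p^`().[t] = k * (a%:R * t ^+ a.-1 * (c - t ^+ 2) - 2 * t * t ^+ a).
  rewrite /p derivM derivC derivM derivB derivC !derivXn !hornerE /= !hornerMn
    !hornerE.
  by rewrite -[_ *+ a]mulr_natl; move: (t ^+ a) (t ^+ a.-1) (a%:R) => u v w;
    ring.
rewrite -[RHS](_ : (p.[s] - p.[- s])%:E = 0%E); last first.
  rewrite /p !hornerM !hornerD !hornerN !hornerXn !hornerC sqrrN s2.
  by rewrite subrr !mul0r !mulr0 subrr.
rewrite -integral_deriv_poly; last by rewrite gtrN.
rewrite [RHS]integral_mkcond; apply: eq_integral => t _.
have tE : (- s <= t <= s) = (t ^+ 2 <= c).
  by rewrite -ler_norml -s2 -[t ^+ 2]real_normK ?num_real// ler_sqr ?nnegrE//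
    ltW.
rewrite patchE -pE mem_setE in_itv/= tE.
by case: (t ^+ 2 <= c); rewrite ?mul1r ?mul0r.
Qed.

(** [sqnorm] for tuples of any length, the empty one included, as the induction
    over the number of coordinates requires. *)
Definition sqn n (x : n.-tuple R) : R := \sum_(i < n) tnth x i ^+ 2.
(** Exponents are indexed by all natural numbers, so that removing the first
    coordinate is just composition with the successor. *)
Definition monomial n (al : nat -> nat) (x : n.-tuple R) : R :=
  \prod_(j < n) tnth x j ^+ al j.

Lemma sqn_cons n t (x : n.-tuple R) : sqn (cons_pair (t, x)) = t ^+ 2 + sqn x.
Proof. by rewrite /sqn big_ord_recl; congr (_ + _); apply: eq_bigr => i _;
  rewrite tnthS. Qed.

Lemma monomial_cons n al t (x : n.-tuple R) :
  monomial al (cons_pair (t, x)) = t ^+ al 0 * monomial (al \o succn) x.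
Proof.
by rewrite /monomial big_ord_recl; congr (_ * _); apply: eq_bigr => i _;
  rewrite tnthS.
Qed.

Lemma measurable_sqn n : measurable_fun setT (@sqn n).
Proof.
apply: measurable_sum => i.
by apply: measurable_funX; exact: measurable_tnth.
Qed.

Lemma measurable_monomial n al : measurable_fun setT (@monomial n al).
Proof.
apply: measurable_prod => i _.
by apply: measurable_funX; exact: measurable_tnth.
Qed.

Lemma sqn_ge0 n (x : n.-tuple R) : 0 <= sqn x.
Proof. by apply: sumr_ge0 => i _; exact: sqr_ge0. Qed.

Lemma le_sqn n (x : n.-tuple R) i : tnth x i ^+ 2 <= sqn x.
Proof. by rewrite /sqn (bigD1 i)//= lerDl sumr_ge0// => j _; exact: sqr_ge0.
Qed.

Lemma norm_le_sqn n (x : n.-tuple R) (b : R) i : 1 <= b -> sqn x <= b ->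
  `|tnth x i| <= b.
Proof.
move=> b1 xb; have b0 : 0 <= b by exact: le_trans b1.
rewrite -ler_sqr ?nnegrE// real_normK ?num_real//.
by rewrite (le_trans (le_sqn x i))// (le_trans xb)// expr2 ler_peMl.
Qed.

Lemma norm_monomial_le n al (x : n.-tuple R) (b : R) : 1 <= b -> sqn x <= b ->
  `|monomial al x| <= \prod_(j < n) b ^+ al j.
Proof.
move=> b1 xb; rewrite normr_prod; apply: ler_prod => i _.
rewrite normr_ge0/= normrX lerXn2r ?nnegrE//; last exact: norm_le_sqn.
exact: le_trans b1.
Qed.

Lemma integrable_bounded_ball n (f : n.-tuple R -> R) (c C : R) :
  measurable_fun setT f -> (forall x, sqn x <= c -> `|f x| <= C) ->
  (forall x, c < sqn x -> f x = 0) -> (@tuple_lebesgue R n).-integrable setT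
    (EFin \o f).
Proof.
move=> mf fC f0.
pose b := Num.max 1 c; have b1 : 1 <= b by rewrite le_max lexx.
pose D := cube n (- b) b.
have mD : measurable D by exact: measurable_cube.
have Dxc x : sqn x <= c -> D x.
  move=> xc i; rewrite /= in_itv/= -ler_norml; apply: norm_le_sqn => //.
  by rewrite le_max xc orbT.
have Ef : EFin \o f = (EFin \o f) \_ D.
  apply/funext => x; rewrite patchE; case: ifPn => // xD.
  rewrite /= f0// ltNge; apply/negP => /Dxc xD'.
  by move: xD; rewrite notin_setE.
rewrite Ef; apply/integrable_restrict => //; rewrite setTI.
apply: measurable_bounded_integrable => //.
- rewrite /tuple_lebesgue lebesgue_tuple_cube ?ltry//.
  by rewrite (@le_trans _ _ 0)// ?oppr_le0 (le_trans _ b1).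
- exact: measurable_funTS.
- apply: filterS (nbhs_pinfty_ge (num_real `|C|)) => M CM x _ /=.
  have [xc|xc] := leP (sqn x) c.
    by rewrite (le_trans (fC _ xc))// (le_trans (ler_norm _)).
  by rewrite f0// normr0 (le_trans _ CM).
Qed.

(** The partial derivative in x_i of (c - |x|^2) x^al, cut off outside the ball
    |x|^2 <= c. The truncated exponent is harmless: when al i = 0 the term that
    contains it has coefficient 0. *)
Definition ibp_integrand n (al : nat -> nat) (i : 'I_n) (c : R) (x :
  n.-tuple R) :=
  (sqn x <= c)%R%:R * ((al i)%:R * monomial (fun j => al j - (j == i))%N x *
     (c - sqn x) - 2 * tnth x i * monomial al x).

Lemma integrable_ibp n al (i : 'I_n) c :
  (@tuple_lebesgue R n).-integrable setT (EFin \o ibp_integrand al i c).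
Proof.
pose b := Num.max 1 c; have b1 : 1 <= b by rewrite le_max lexx.
pose P (be : nat -> nat) : R := \prod_(j < n) b ^+ be j.
apply: (@integrable_bounded_ball _ _ c
  ((al i)%:R * P (fun j => al j - (j == i))%N * c + 2 * b * P al)).
- apply: measurable_funM.
    rewrite (_ : (fun x => _) = fun x : n.-tuple R => if sqn x <= c then 1 else
      0); last first.
      by apply/funext => x; case: (sqn x <= c).
    by apply: measurable_fun_ifT => //; apply: measurable_fun_ler => //;
      exact: measurable_sqn.
  apply: measurable_funB; apply: measurable_funM.
  + by apply: measurable_funM => //; exact: measurable_monomial.
  + by apply: measurable_funB => //; exact: measurable_sqn.
  + by apply: measurable_funM => //; exact: measurable_tnth.
  + exact: measurable_monomial.
- move=> x xc; have xb : sqn x <= b by rewrite le_max xc orbT.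
  rewrite /ibp_integrand xc mul1r (le_trans (ler_normB _ _))// lerD//.
    rewrite !normrM ler_pM//.
      by rewrite ler_pM// ?normr_nat//; exact: norm_monomial_le.
    by rewrite ger0_norm ?subr_ge0// gerBl sqn_ge0.
  rewrite !normrM ler_pM//; last exact: norm_monomial_le.
  by rewrite normr_nat ler_pM//; exact: norm_le_sqn.
- by move=> x xc; rewrite /ibp_integrand leNgt xc mul0r.
Qed.

(** Divergence theorem without boundary term, as (c - |x|^2) x^al vanishes on
    the boundary. By induction on the number of coordinates: if x_i is the first
    one, the integral along it is zero on every line; otherwise freezing the
    first coordinate t leaves the same integral with c - t^2 in place of c. *)
Lemma ball_integration_by_parts n al (i : 'I_n) c :
  (\int[@tuple_lebesgue R n]_x (ibp_integrand al i c x)%:E = 0)%E.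
Proof.
elim: n al i c => [|n IHn] al i c; first by case: i.
have := integrable_ibp al i c; case: (unliftP ord0 i) => [j ->|->] intF.
  rewrite integral_cons12// integral0_eq// => t _.
  transitivity (\int[@tuple_lebesgue R n]_x ((t ^+ al 0)%:E * (ibp_integrand
    (al \o succn) j (c - t ^+ 2) x)%:E))%E.
    apply: eq_integral => x _; rewrite -EFinM; congr EFin.
    rewrite /ibp_integrand sqn_cons !monomial_cons tnthS/= subn0.
    rewrite lerBrDl opprD addrA /comp.
    by rewrite /bump /=; ring.
  by rewrite integralZl ?IHn ?mule0//; exact: integrable_ibp.
rewrite integral_cons21// integral0_eq// => x _.
rewrite -(integral_ibp_line (monomial (al \o succn) x) (c - sqn x) (al 0%N)).
apply: eq_integral => t _; congr EFin.
rewrite /ibp_integrand sqn_cons !monomial_cons /= subn1 lerBrDr.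
rewrite (_ : ((fun j => _) \o succn) = al \o succn); last first.
  by apply/funext => j; rewrite /= subn0.
rewrite (_ : tnth (cons_pair (t, x)) ord0 = t)//; ring.
Qed.

End ball_integration_by_parts.

(** * Polar coordinates and moments of the sphere *)

Section polar_coordinates.
Variables (R : realType) (m : nat).
Local Notation E := (m.+1.-tuple R).
Local Notation S := (sphere R m).
Local Notation sigma := (surface_measure R m).
Local Notation omega := (total_area R m).
Local Notation PB := (@punctured_ball R m).
Local Notation RR := (measurableTypeR R).

Definition radius (x : E) : RR := Num.sqrt (sqnorm x).

Lemma measurable_radius : measurable_fun setT radius.
Proof.
rewrite (_ : radius = fun x => sqnorm x `^ 2^-1).
  by apply: (measurableT_comp (measurable_powR _)); exact: measurable_sqnorm.
apply/funext => x; rewrite powR12_sqrt// sumr_ge0// => j _; exact: sqr_ge0.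
Qed.

Let mPB : measurable PB. Proof. exact: measurable_punctured_ball. Qed.

Definition ball_measure (A : set E) : \bar R := mrestr (@tuple_lebesgue R m.+1)
  mPB A.
HB.instance Definition _ := isMeasure.Build _ _ _ ball_measure
  (measure0 _) (measure_ge0 _) (@measure_semi_sigma_additive _ _ _ (mrestr
    (@tuple_lebesgue R m.+1) mPB)).

Lemma ball_measure_fin : fin_num_fun ball_measure.
Proof.
apply: lty_fin_num_fun; rewrite /= /ball_measure /mrestr setTI.
by have /andP[] := lebesgue_tuple_punctured_ball R m.
Qed.
HB.instance Definition _ := Measure_isFinite.Build _ _ _ ball_measure
  ball_measure_fin.

Definition radius_law (T : set RR) : \bar R := pushforward ball_measure radius
  T.
Let pf := measure_function_pushforward__canonical__measure_function_Measure
   ball_measure measurable_radius.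
HB.instance Definition _ := isMeasure.Build _ _ _ radius_law
  (measure0 pf) (measure_ge0 pf) (@measure_semi_sigma_additive _ _ _ pf).
Lemma radius_law_fin : fin_num_fun radius_law.
Proof.
apply: lty_fin_num_fun; rewrite /= /radius_law /pushforward preimage_setT.
exact/fin_num_fun_lty/ball_measure_fin.
Qed.
HB.instance Definition _ := Measure_isFinite.Build _ _ _ radius_law
  radius_law_fin.

Lemma sqnormE (x : E) : sqnorm x = sqn x. Proof. by []. Qed.

Lemma sqn_dilation n r (x : n.-tuple R) : sqn (dilation r x) = r ^+ 2 * sqn x.
Proof.
by rewrite /sqn mulr_sumr; apply: eq_bigr => i _; rewrite tnth_mktuple exprMn.
Qed.

Lemma radial_dilation r (x : E) : 0 < r -> @radial R m (dilation r x) =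
  @radial R m x.
Proof.
move=> r0; congr insubd; apply: eq_from_tnth => i; rewrite !tnth_mktuple.
rewrite sqnormE sqn_dilation sqrtrM ?sqr_ge0// sqrtr_sqr (ger0_norm (ltW r0)).
by rewrite invfM mulrACA divff ?mul1r// gt_eqF.
Qed.

Lemma measurable_radial_preimage (A : set S) : measurable A ->
  measurable (@radial R m @^-1` A).
Proof. by move=> mA; rewrite -[X in measurable X]setTI;
  exact: measurable_radial. Qed.

(** Within the cone over A, the points of norm at most b are the image of the
    whole cone under the dilation of ratio b. *)
Lemma ball_measure_cone_ray (A : set S) (b : R) : measurable A ->
  ball_measure (radius @^-1` `]-oo, b] `&` @radial R m @^-1` A) =
  ((Num.min (Num.max b 0) 1 ^+ m.+1)%:E * ball_measure (@radial R m @^-1` A))%E.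
Proof.
move=> mA; have [b0|b0] := leP b 0.
  rewrite min_l// expr0n mul0e /ball_measure /mrestr.
  rewrite (_ : _ `&` _ = set0) ?measure0//.
  apply/seteqP; split => // x [[/= + _] /andP[x0 _]].
  rewrite in_itv/= => /le_trans /(_ b0); rewrite leNgt sqrtr_gt0.
  by rewrite x0.
have [b1|b1] := leP b 1; last first.
  rewrite expr1n mul1e /ball_measure /mrestr; congr (tuple_lebesgue _).
  apply/seteqP; split => x; first by move=> [[_ ?] ?]; split.
  move=> [xA xB]; split => //; split => //=; rewrite in_itv/=.
  have /andP[_ x1] := xB; apply: le_trans (ltW b1).
  by rewrite -[leRHS]sqrtr1 ler_wsqrtr.
have bi0 : 0 < b^-1 by rewrite invr_gt0.
have := @tuple_lebesgue_dilation R m.+1 _ (@radial R m @^-1` A `&` PB) bi0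
  (measurableI _ _ (measurable_radial_preimage mA) mPB).
rewrite invrK /ball_measure /mrestr => <-; congr (tuple_lebesgue _).
apply/seteqP; split => x /=.
  move=> [[xb xA] /andP[x0 x1]]; rewrite radial_dilation//; split => //.
  rewrite /punctured_ball/= !sqnormE sqn_dilation mulr_gt0 ?exprn_gt0//=.
  rewrite exprVn mulrC ler_pdivrMr ?exprn_gt0// mul1r.
  move: xb; rewrite in_itv/= => xb; rewrite -[leLHS]sqr_sqrtr ?(ltW x0)//.
  by rewrite lerXn2r ?nnegrE ?sqrtr_ge0// ltW.
move=> []; rewrite radial_dilation// => xA /andP[].
rewrite !sqnormE sqn_dilation pmulr_rgt0 ?exprn_gt0// => x0.
rewrite exprVn mulrC ler_pdivrMr ?exprn_gt0// mul1r => xb.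
split; [split => //|].
  rewrite in_itv/= /radius -[leRHS]ger0_norm ?(ltW b0)// -sqrtr_sqr.
  exact: ler_wsqrtr.
apply/andP; split => //; by rewrite (le_trans xb)// expr_le1// ltW.
Qed.

Lemma ball_measure_cone (A : set S) : measurable A ->
  sigma A = (m.+1%:R%:E * ball_measure (@radial R m @^-1` A))%E.
Proof. by []. Qed.

(** Radius and direction are independent under the normalised measure of the
    ball. Both sides are finite measures in T, and they agree on the rays ]-oo,
    b] because the dilation factor in [ball_measure_cone_ray] is the same for
    every A. *)
Lemma ball_measure_polar (T : set RR) (A : set S) : measurable T ->
  measurable A ->
  (ball_measure setT * ball_measure (radius @^-1` T `&` @radial R m @^-1` A) =
   radius_law T * ball_measure (@radial R m @^-1` A))%E.
Proof.
move=> mT mA.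
have mrA := measurable_radial_preimage mA.
have bfin B : measurable B -> ball_measure B \is a fin_num by exact:
  ball_measure_fin.
have f0 B : measurable B -> 0 <= fine (ball_measure B).
  by move=> mB; exact/fine_ge0/measure_ge0.
(* m1 and m2 are the two sides as measures in T *)
have [m1 m1E] : exists m1 : {measure set RR -> \bar R}, forall X, m1 X =
    (ball_measure setT * ball_measure (radius @^-1` X `&` @radial R m @^-1`
      A))%E.
  exists (mscale (NngNum (f0 _ measurableT))
    (measure_function_pushforward__canonical__measure_function_Measure
      (mrestr ball_measure mrA) measurable_radius)) => X.
  by rewrite -[X in (X * _)%E](fineK (bfin _ measurableT)).
have [m2 m2E] : exists m2 : {measure set RR -> \bar R}, forall X, m2 X =
    (ball_measure (@radial R m @^-1` A) * radius_law X)%E.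
  exists (mscale (NngNum (f0 _ mrA)) radius_law) => X.
  by rewrite -[X in (X * _)%E](fineK (bfin _ mrA)).
suff m12 : m1 T = m2 T by rewrite -m1E m12 m2E; exact: muleC.
pose G : set (set RR) := [set A | exists b, A = `]-oo, b]%classic].
have GE : (measurable : set (set RR)) = <<s G >>.
  apply/seteqP; split.
    have -> : (measurable : set (set RR)) = (@RGenOInfty.G
      R).-sigma.-measurable.
      exact: RGenOInfty.measurableE.
    apply: smallest_sub; first exact: smallest_sigma_algebra.
    move=> _ [b ->]; rewrite -setCitvl.
    rewrite -setTD; apply: sigma_algebraCD; apply: sub_sigma_algebra.
    by exists b.
  apply: smallest_sub; first exact: sigma_algebra_measurable.
  by move=> _ [b ->]; exact: measurable_itv.
apply: (@measure_unique _ _ _ G (fun k => `]-oo, k%:R]%classic)) => //.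
- move=> _ _ [a ->] [b ->]; exists (Num.min a b).
  by apply/seteqP; split=> x /=; rewrite !in_itv/= le_min => /andP.
- by move=> k; exists k%:R.
- apply/seteqP; split=> // x _.
  exists (Num.Def.archi_bound x) => //=; rewrite in_itv/=.
  have [x0|x0] := leP 0 x; first exact/ltW/archi_boundP.
  by rewrite (le_trans (ltW x0)).
- move=> _ [b ->]; rewrite m1E m2E ball_measure_cone_ray//.
  have := ball_measure_cone_ray b (@measurableT _ S).
  by rewrite preimage_setT setIT /radius_law /pushforward => ->;
    rewrite muleCA [RHS]muleCA; congr (_ * _)%E; exact: muleC.
- move=> k; rewrite m1E -ge0_fin_numE ?mule_ge0 ?measure_ge0//.
  by rewrite fin_numM ?bfin//; apply: measurableI => //;
    rewrite -[X in measurable X]setTI; exact: measurable_radius.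
Qed.
End polar_coordinates.

Lemma integral_mscale d (T : measurableType d) (R : realType) (k : {nonneg R})
  (mu : {measure set T -> \bar R}) (f : T -> \bar R) : mu.-integrable setT f ->
  (\int[mscale k mu]_x f x = k%:num%:E * \int[mu]_x f x)%E.
Proof.
move=> intf; have /integrableP[mf _] := intf.
rewrite (integralE (mscale k mu) setT f) (integralE mu setT f).
rewrite !ge0_integral_mscale//; last 2 first.
- exact: measurable_funeneg.
- exact: measurable_funepos.
rewrite [RHS]muleBr//; apply: fin_num_adde_defl;
  rewrite fin_numN; exact: integrable_neg_fin_num.
Qed.

Section polar_integral.
Variables (R : realType) (m : nat).
Local Notation E := (m.+1.-tuple R).
Local Notation S := (sphere R m).
Local Notation sigma := (surface_measure R m).
Local Notation omega := (total_area R m).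
Local Notation PB := (@punctured_ball R m).
Local Notation RR := (measurableTypeR R).
Local Notation radial := (@radial R m).
Local Notation radius := (@radius R m).
Local Notation ball := (@ball_measure R m).
Local Notation rlaw := (@radius_law R m).

Lemma bounded_integrable d (T : measurableType d) (mu : {finite_measure set T
  -> \bar R})
    (f : T -> R) (C : R) : measurable_fun setT f -> (forall x, `|f x| <= C) ->
  mu.-integrable setT (EFin \o f).
Proof.
move=> mf fC; apply: measurable_bounded_integrable => //.
  exact/fin_num_fun_lty/fin_num_measure.
by apply: filterS (nbhs_pinfty_ge (num_real C)) => M CM x _ /=;
  rewrite (le_trans (fC x)).
Qed.

Let polar_pair (x : E) : RR * S := (radius x, radial x).
Let mpolar_pair : measurable_fun setT polar_pair.
Proof.
apply: measurable_fun_pair; first exact: measurable_radius.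
exact: measurable_radial.
Qed.

(** By [ball_measure_polar] the image of the ball under x |-> (|x|, x/|x|) is,
    up to the factor omega, a product measure. *)
Lemma polar_integral (w : RR -> R) (phi : S -> R) (C D : R) :
  measurable_fun setT w -> measurable_fun setT phi ->
  (forall r, `|w r| <= C) -> (forall x, `|phi x| <= D) ->
  omega * \int[ball]_x (w (radius x) * phi (radial x)) =
  (\int[rlaw]_r w r) * \int[sigma]_x phi x.
Proof.
move=> mw mphi wC phiD.
have o0 := ltW (@total_area_gt0 R m).
have iw : rlaw.-integrable setT (EFin \o w)  by exact: bounded_integrable mw wC.
have iphi : sigma.-integrable setT (EFin \o phi) by exact: bounded_integrable
  mphi phiD.
pose F (p : RR * S) := w p.1 * phi p.2.
have mF : measurable_fun setT F by apply: measurable_funM;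
  apply: measurableT_comp.
have FCD p : `|F p| <= C * D by rewrite /F normrM ler_pM.
have iF : (rlaw \x sigma)%E.-integrable setT (EFin \o F).
  apply: measurable_bounded_integrable => //.
    rewrite -setXTT; have /= -> := @product_measure1E _ _ _ _ _ rlaw sigma setT
      setT measurableT measurableT.
    rewrite lte_mul_pinfty//.
    - exact: fin_num_measure.
    - exact/fin_num_fun_lty/fin_num_measure.
  by apply: filterS (nbhs_pinfty_ge (num_real (C * D))) => M CM x _ /=;
    rewrite (le_trans (FCD x)).
have mFp : measurable_fun setT (F \o polar_pair) by exact: measurableT_comp.
have iFp : ball.-integrable setT (EFin \o (F \o polar_pair)).
  by apply: (@bounded_integrable _ _ _ _ (C * D)) => // x; exact: FCD.
pose pb := measure_function_pushforward__canonical__measure_function_Measure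
   ball mpolar_pair.
have ipb : pb.-integrable setT (EFin \o F).
  by apply: integrable_pushforward => //; exact/measurable_EFinP.
have E1 : (\int[rlaw \x sigma]_p (F p)%:E = omega%:E * \int[ball]_x
  (F (polar_pair x))%:E)%E.
  transitivity (\int[mscale (NngNum o0) pb]_p (F p)%:E)%E.
    apply: eq_measure_integral => X mX _.
    apply: product_measure_unique => // A B mA mB.
    transitivity (omega%:E * ball (radius @^-1` A `&` radial @^-1` B))%E;
      first by [].
    have -> : omega%:E = sigma setT by rewrite /total_area fineK//
      fin_num_measure.
    rewrite !ball_measure_cone// preimage_setT -muleA ball_measure_polar//.
    by rewrite muleCA.
  rewrite integral_mscale//; congr (_ * _)%E.
  rewrite integral_pushforward//; exact/measurable_EFinP.
have E2 : (\int[rlaw \x sigma]_p (F p)%:E = (\int[rlaw]_r (w r)%:E) *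
  \int[sigma]_x (phi x)%:E)%E.
  rewrite -(integral12_prod_meas1 iF) /fubini_F.
  under eq_integral => r _.
    under eq_integral => x _ do rewrite /= /F/= EFinM.
    rewrite integralZl//.
    rewrite -[X in (_ * X)%E](fineK (integrable_fin_num measurableT iphi))//.
    over.
  by rewrite -[X in (_ * X)%E](fineK (integrable_fin_num measurableT iphi))//
    integralZr.
rewrite /Rintegral -fineM ?integrable_fin_num// -E2 E1 fineM//.
exact: (integrable_fin_num measurableT iFp).
Qed.

End polar_integral.

Section spherical_moments.
Variables (R : realType) (m : nat).
Local Notation E := (m.+1.-tuple R).
Local Notation S := (sphere R m).
Local Notation sigma := (surface_measure R m).
Local Notation omega := (total_area R m).
Local Notation PB := (@punctured_ball R m).
Local Notation RR := (measurableTypeR R).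
Local Notation radial := (@radial R m).
Local Notation radius := (@radius R m).
Local Notation ball := (@ball_measure R m).
Local Notation rlaw := (@radius_law R m).
Local Notation leb := (@tuple_lebesgue R m.+1).

Lemma measurable_sphere_val : measurable_fun setT (val : S -> E).
Proof. by move=> _ B mB; exists B. Qed.

Lemma integral_ball (f : E -> R) : ball.-integrable setT (EFin \o f) ->
  (\int[ball]_x (f x)%:E = \int[leb]_(x in PB) (f x)%:E)%E.
Proof.
move=> intf; have mPB := @measurable_punctured_ball R m.
have N0 : ball (~` PB) = 0%E by rewrite /ball_measure /mrestr setICl measure0.
have -> := negligible_integral (measurableC mPB) measurableT intf N0.
rewrite setTD setCK; apply: eq_measure_integral => A mA AB.
by rewrite -[X in _ = leb X](setIidl AB).
Qed.

Lemma tuple_lebesgue_origin : leb [set x | sqn x = 0] = 0%E.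
Proof.
rewrite (_ : [set x | _] = cube m.+1 0 0).
  by rewrite /tuple_lebesgue lebesgue_tuple_cube// subrr expr0n.
apply/seteqP; split => x /=.
  move=> x0 i; rewrite in_itv/= -eq_le; apply/eqP.
  apply/eqP; rewrite eq_sym -sqrf_eq0 eq_le sqr_ge0 andbT -x0.
  exact: le_sqn.
move=> x0; rewrite /sqn big1// => i _; have := x0 i.
by rewrite in_itv/= => /le_anti <-; rewrite expr0n.
Qed.

(** Away from the origin the normalised tuple lies on the sphere, so [radial]
    takes its proper value and not its default. *)
Lemma val_radial x : 0 < sqnorm x ->
  val (radial x) = [tuple tnth x i / radius x | i < m.+1].
Proof.
move=> x0; rewrite val_insubd ifT// /sqnorm.
under eq_bigr do rewrite tnth_mktuple exprMn exprVn sqr_sqrtr ?(ltW x0)//.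
by rewrite -mulr_suml divff// gt_eqF.
Qed.

Definition degree (al : nat -> nat) := (\sum_(j < m.+1) al j)%N.

Lemma monomial_radial (al : nat -> nat) x : 0 < sqnorm x ->
  monomial al x = radius x ^+ degree al * monomial al (val (radial x)).
Proof.
move=> x0; rewrite val_radial// /monomial /degree -prodrXr -big_split/=.
apply: eq_bigr => j _; rewrite tnth_mktuple -exprMn mulrCA divff ?mulr1//.
by rewrite gt_eqF// sqrtr_gt0.
Qed.

Lemma sqn_sphere (x : S) : sqn (val x) = 1.
Proof. exact/eqP/(valP x). Qed.

Lemma norm_monomial_sphere al (x : S) : `|monomial al (val x)| <= 1.
Proof.
have := @norm_monomial_le R _ al (val x) 1 (lexx _);
  rewrite sqn_sphere => /(_ (lexx _)).
by rewrite big1// => j _; rewrite expr1n.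
Qed.

Lemma measurable_monomial_sphere al : measurable_fun setT (fun x : S =>
  monomial al (val x)).
Proof. by apply: (measurableT_comp (@measurable_monomial _ _ _));
  exact: measurable_sphere_val. Qed.

Definition moment al : R := \int[sigma]_x monomial al (val x).

Let clip (r : RR) : R := Num.min (Num.max r 0) 1.

Let clip01 r : 0 <= clip r <= 1.
Proof. by rewrite /clip le_min ler01 le_max lexx orbT/= ge_min lexx orbT. Qed.

Let mclip : measurable_fun setT clip.
Proof. by apply: measurable_minr => //; apply: measurable_maxr. Qed.

Let clip_radius x : PB x -> clip (radius x) = radius x.
Proof.
move=> /andP[x0 x1]; rewrite /clip max_l ?sqrtr_ge0// min_l//.
by rewrite -[leRHS]sqrtr1 ler_wsqrtr.
Qed.

(** Both terms of the integration by parts on the unit ball are integrals of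
    homogeneous functions times a radial weight; in polar coordinates each is a
    radial constant times a moment of the sphere. The constants depend only on
    the degree of al, and the one attached to x_i x^al is positive, so it can be
    moved to the other side. *)
Lemma spherical_integration_by_parts : exists kappa : nat -> R,
  forall al (i : 'I_m.+1),
    moment (fun j => al j + (j == i))%N =
    kappa (degree al) * ((al i)%:R * moment (fun j => al j - (j == i))%N).
Proof.
pose w1 s (r : RR) := clip r ^+ s.-1 * (1 - clip r ^+ 2).
pose w2 s (r : RR) := clip r ^+ s.+1.
have w1b s r : `|w1 s r| <= 1.
  have /andP[c0 c1] := clip01 r.
  rewrite /w1 normrM !ger0_norm ?exprn_ge0// ?subr_ge0 ?exprn_ile1//.
  by rewrite mulr_ile1 ?exprn_ge0 ?subr_ge0 ?exprn_ile1// gerBl exprn_ge0.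
have w2b s r : `|w2 s r| <= 1.
  have /andP[c0 c1] := clip01 r.
  by rewrite /w2 ger0_norm ?exprn_ge0// exprn_ile1.
have mw1 s : measurable_fun setT (w1 s).
  apply: measurable_funM; first exact: measurable_funX.
  by apply: measurable_funB => //; exact: measurable_funX.
have mw2 s : measurable_fun setT (w2 s) by exact: measurable_funX.
(* the weight vanishes only at radius 0, which the punctured ball excludes *)
have w2pos s : 0 < \int[rlaw]_r w2 s r.
  have w20 r : 0 <= w2 s r by have /andP[c0 _] := clip01 r; exact: exprn_ge0.
  have iw2 : rlaw.-integrable setT (EFin \o w2 s) by exact: bounded_integrable
    (mw2 s) (w2b s).
  rewrite lt_neqAle Rintegral_ge0// andbT eq_sym; apply/eqP => J0.
  have : (\int[rlaw]_r `|(w2 s r)%:E| = 0)%E.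
    rewrite (eq_integral (EFin \o w2 s)); last by move=> r _;
      rewrite gee0_abs// lee_fin.
    by rewrite -[LHS]fineK ?(integrable_fin_num measurableT iw2)//; congr EFin.
  have mEw2 : measurable_fun setT (EFin \o w2 s) by exact/measurable_EFinP.
  move=> /(ae_eq_integral_abs _ measurableT mEw2)[N [mN N0 subN]].
  have /andP[+ _] := lebesgue_tuple_punctured_ball R m.
  suff : (ball PB <= 0)%E by rewrite /ball_measure /mrestr setIid leNgt =>
    /negP.
  rewrite -N0; apply: le_measure.
  - by rewrite inE; exact: measurable_punctured_ball.
  - by rewrite inE -[X in measurable X]setTI; exact: measurable_radius.
  move=> x xB; apply: subN => /= /(_ I) [].
  move=> /eqP; rewrite /w2 clip_radius// expf_eq0/= => /eqP r0.
  by have /andP[+ _] := xB; rewrite -sqrtr_gt0 -/(radius x) r0 ltxx.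
exists (fun s => (\int[rlaw]_r w1 s r) / (2 * \int[rlaw]_r w2 s r)) => al i.
pose al1 j := (al j + (j == i))%N.
pose al0 j := (al j - (j == i))%N.
pose f1 x := w1 (degree al) (radius x) * monomial al0 (val (radial x)).
pose f2 x := w2 (degree al) (radius x) * monomial al1 (val (radial x)).
have mon1 x : tnth x i * monomial al x = monomial al1 x.
  rewrite /monomial (bigD1 i)//= [in RHS](bigD1 i)//= /al1 eqxx addn1 exprS
    mulrA.
  by congr (_ * _); apply: eq_bigr => j ji; rewrite val_eqE (negbTE ji) addn0.
have deg1 : degree al1 = (degree al).+1.
  rewrite /degree (bigD1 i)//= [in RHS](bigD1 i)//= /al1 eqxx addn1 addSn.
  by congr (_ + _).+1; apply: eq_bigr => j ji;
    rewrite val_eqE (negbTE ji) addn0.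
have deg0 : (0 < al i)%N -> degree al0 = (degree al).-1.
  move=> ai; rewrite /degree (bigD1 i)//= [in RHS](bigD1 i)//= /al0 eqxx subn1.
  rewrite -[in RHS](prednK ai) addSn/=.
  by congr (_ + _)%N; apply: eq_bigr => j ji; rewrite val_eqE (negbTE ji) subn0.
have ifw (w : RR -> R) be : measurable_fun setT w -> (forall r, `|w r| <= 1) ->
    ball.-integrable setT (EFin \o (fun x => w (radius x) * monomial be
      (val (radial x)))).
  move=> mw wb; apply: (@bounded_integrable _ _ _ _ _ 1).
    apply: measurable_funM; first by apply: measurableT_comp => //;
      exact: measurable_radius.
    apply: (@measurableT_comp _ _ _ _ _ _ (fun y : S => monomial be (val y))).
      exact: measurable_monomial_sphere.
    exact: measurable_radial.
  by move=> x; rewrite normrM mulr_ile1// norm_monomial_sphere.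
have if1 : ball.-integrable setT (EFin \o f1) by exact: ifw.
have if2 : ball.-integrable setT (EFin \o f2) by exact: ifw.
have if12 : ball.-integrable setT (EFin \o (fun x => (al i)%:R * f1 x - 2 * f2
  x)).
  rewrite (_ : _ \o _ = (fun x => (al i)%:R%:E * (f1 x)%:E - 2%:E *
    (f2 x)%:E)%E); last first.
    by apply/funext.
  by apply: integrableB => //; apply: integrableZl.
(* both terms are homogeneous; when al i = 0 the degree of al0 is off by one,
   but its coefficient is zero *)
have f12E x : PB x -> (al i)%:R * f1 x - 2 * f2 x = ibp_integrand al i 1 x.
  move=> xB; have /andP[x0 x1] := xB.
  rewrite /ibp_integrand -[sqn x]/(sqnorm x) x1 mul1r -[2 * tnth x i * _]mulrA
    mon1 (@monomial_radial al1)//.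
  rewrite /f1 /f2 /w1 /w2 clip_radius// deg1; congr (_ - _).
  have [->|ai] := posnP (al i); first by rewrite !mul0r.
  rewrite -/al0 (@monomial_radial al0 x)// deg0// sqr_sqrtr ?(ltW x0)//.
  by rewrite -!mulrA; congr (_ * (_ * _)); rewrite mulrC.
have ibp0 : \int[ball]_x ((al i)%:R * f1 x - 2 * f2 x) = 0.
  rewrite /Rintegral integral_ball//.
  have mZ : measurable [set x : E | sqn x = 0].
    rewrite (_ : [set _ | _] = @sqn R m.+1 @^-1` [set 0]) //.
    by rewrite -[X in measurable X]setTI; exact: measurable_sqn.
  have := negligible_integral mZ measurableT (integrable_ibp al i 1)
    tuple_lebesgue_origin.
  rewrite [X in X = _](ball_integration_by_parts al i 1) setTD integral_mkcond
    => /esym H0.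
  apply: (@etrans _ _ (fine (0%E : \bar R))) => //.
  rewrite -[in RHS]H0 [in LHS]integral_mkcond; congr fine.
  apply: eq_integral => x _; rewrite !patchE.
  have [/[!inE] xB|xB] := boolP (x \in PB).
    rewrite ifT ?f12E// inE => /= x0; have /andP[] := xB.
    by rewrite -[sqnorm x]/(sqn x) x0 ltxx.
  case: ifPn => // /[!inE] /= x0; rewrite /ibp_integrand leNgt.
  case: ltP => [_|x1]; first by rewrite mul0r.
  exfalso; move: xB; rewrite notin_setE; apply; apply/andP; split => //.
  by rewrite lt_neqAle eq_sym sqn_ge0 andbT; apply/eqP.
have P1 := polar_integral (mw1 (degree al)) (@measurable_monomial_sphere al0)
  (w1b _) (norm_monomial_sphere _).
have P2 := polar_integral (mw2 (degree al)) (@measurable_monomial_sphere al1)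
  (w2b _) (norm_monomial_sphere _).
move/(congr1 ( *%R omega)): ibp0.
have izl (k : R) f : ball.-integrable setT (EFin \o f) ->
    ball.-integrable setT (EFin \o (fun x => k * f x)).
  by move=> intf; have := integrableZl measurableT k intf.
rewrite RintegralB//; [|exact: izl|exact: izl].
rewrite !RintegralZl// mulr0 mulrBr mulrCA P1 [X in _ - X]mulrCA P2.
move/eqP; rewrite subr_eq0 => /eqP; rewrite -/(moment _) -/(moment _) => E.
apply: (@mulfI _ (2 * \int[rlaw]_r w2 (degree al) r)).
  by rewrite mulf_neq0// gt_eqF.
rewrite -mulrA -E.
by rewrite mulrA mulrCA -/al0; field; rewrite gt_eqF.
Qed.

End spherical_moments.

(** * Complex-valued square-integrable functions *)

Section complex_integral.
Context d (T : measurableType d) (R : realType).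
Variable mu : {measure set T -> \bar R}.
Local Notation C := R[i].
Implicit Types f g : T -> C.

Lemma absc_sqE (z : C) : absc z ^+ 2 = complex.Re z ^+ 2 + complex.Im z ^+ 2.
Proof. by rewrite /absc normc_def/= sqr_sqrtr// addr_ge0 ?sqr_ge0. Qed.

Lemma absc_sq_mulJ (z : C) : (absc z ^+ 2)%:C = z * z^*.
Proof. by case: z => a b; rewrite absc_sqE; simpc; congr (_ +i* _);
  rewrite ?expr2; ring. Qed.

Lemma absc_sqM (y z : C) : absc (y * z) ^+ 2 = absc y ^+ 2 * absc z ^+ 2.
Proof. by case: y => a b; case: z => c e; rewrite !absc_sqE; simpc => /=; ring.
Qed.

Lemma absc_sqD_le (y z : C) : absc (y + z) ^+ 2 <= 2 * (absc y ^+ 2 + absc z ^+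
  2).
Proof.
case: y => a b; case: z => c e; rewrite !absc_sqE; simpc => /=;
  rewrite -subr_ge0.
rewrite (_ : _ - _ = (a - c) ^+ 2 + (b - e) ^+ 2); last by ring.
by rewrite addr_ge0 ?sqr_ge0.
Qed.

(** Integrability of the real and imaginary parts, which is what [cintegral]
    needs to be linear. *)
Definition cintegrable f :=
  mu.-integrable setT (EFin \o (fun x => complex.Re (f x))) /\
  mu.-integrable setT (EFin \o (fun x => complex.Im (f x))).

Lemma integrable_lin (a b : R) (u v : T -> R) :
  mu.-integrable setT (EFin \o u) -> mu.-integrable setT (EFin \o v) ->
  mu.-integrable setT (EFin \o (fun x => a * u x + b * v x)).
Proof.
move=> iu iv.
exact: (integrableD measurableT (integrableZl measurableT a iu) (integrableZl
  measurableT b iv)).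
Qed.

Lemma Rintegral_lin (a b : R) (u v : T -> R) :
  mu.-integrable setT (EFin \o u) -> mu.-integrable setT (EFin \o v) ->
  \int[mu]_x (a * u x + b * v x) = a * \int[mu]_x u x + b * \int[mu]_x v x.
Proof.
move=> iu iv; rewrite RintegralD//.
- by rewrite !RintegralZl.
- exact: (integrableZl measurableT a iu).
- exact: (integrableZl measurableT b iv).
Qed.

Lemma cintegrable_lin (a b : C) f g : cintegrable f -> cintegrable g ->
  cintegrable (fun x => a * f x + b * g x) /\
  cintegral mu (fun x => a * f x + b * g x) =
  a * cintegral mu f + b * cintegral mu g.
Proof.
case: a => a1 a2; case: b => b1 b2 [f1 f2] [g1 g2].
have -> : (fun x => (a1 +i* a2) * f x + (b1 +i* b2) * g x) = (fun x =>
   (1 * (a1 * complex.Re (f x) + (- a2) * complex.Im (f x)) + 1 *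
     (b1 * complex.Re (g x) + (- b2) * complex.Im (g x))) +i*
   (1 * (a1 * complex.Im (f x) + a2 * complex.Re (f x)) + 1 * (b1 * complex.Im
     (g x) + b2 * complex.Re (g x)))).
  by apply/funext => x; case: (f x) => u v; case: (g x) => s t; simpc;
    congr (_ +i* _); ring.
split; first by split => /=; do 2 apply: integrable_lin => //.
rewrite /cintegral/=.
rewrite !Rintegral_lin//; try exact: integrable_lin.
by simpc; congr (_ +i* _); ring.
Qed.

(** [inner2] without its normalisation and over any measure space. *)
Definition hermitian f g : C := cintegral mu (fun x => f x * (g x)^*).

Lemma square_integrableP f : square_integrable mu f <->
  [/\ measurable_fun setT (fun x => complex.Re (f x)),
      measurable_fun setT (fun x => complex.Im (f x)) &
      mu.-integrable setT (EFin \o (fun x => absc (f x) ^+ 2))].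
Proof.
have mabs : measurable_fun setT (fun x => complex.Re (f x)) ->
    measurable_fun setT (fun x => complex.Im (f x)) ->
    measurable_fun setT (fun x => absc (f x) ^+ 2).
  move=> mr mi; under eq_fun do rewrite absc_sqE.
  by apply: measurable_funD; exact: measurable_funX.
have E : (\int[mu]_x `|(absc (f x) ^+ 2)%:E| = \int[mu]_x (absc (f x) ^+
  2)%:E)%E.
  by apply: eq_integral => x _; rewrite gee0_abs// lee_fin sqr_ge0.
split=> -[mr mi fy]; split=> //.
  by apply/integrableP; split; [exact/measurable_EFinP/mabs|rewrite E].
by have /integrableP[_] := fy; rewrite E.
Qed.

Lemma square_integrable_lin (a b : C) f g :
  square_integrable mu f -> square_integrable mu g ->
  square_integrable mu (fun x => a * f x + b * g x).
Proof.
move=> /square_integrableP[fr fi fy] /square_integrableP[gr gi gy];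
  apply/square_integrableP.
have mlin (p q r s : R) (u v w z : T -> R) : measurable_fun setT u ->
  measurable_fun setT v ->
  measurable_fun setT w -> measurable_fun setT z ->
  measurable_fun setT (fun x => p * u x + q * v x + (r * w x + s * z x)).
  by move=> *; apply: measurable_funD; apply: measurable_funD;
    apply: measurable_funM.
have [mr mi] : measurable_fun setT (fun x => complex.Re (a * f x + b * g x)) /\
    measurable_fun setT (fun x => complex.Im (a * f x + b * g x)).
  case: a => a1 a2; case: b => b1 b2; split.
    apply: (eq_measurable_fun _ _ (mlin a1 (- a2) b1 (- b2) _ _ _ _ fr fi gr
      gi)) => x _.
    by case: (f x) => u v; case: (g x) => s t; simpc => /=; ring.
  apply: (eq_measurable_fun _ _ (mlin a1 a2 b1 b2 _ _ _ _ fi fr gi gr)) => x _.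
  by case: (f x) => u v; case: (g x) => s t; simpc => /=; ring.
split => //.
apply: le_integrable (integrable_lin (2 * absc a ^+ 2) (2 * absc b ^+ 2) fy gy)
  => //.
  apply/measurable_EFinP; under eq_fun do rewrite absc_sqE.
  by apply: measurable_funD; exact: measurable_funX.
move=> x _ /=; rewrite lee_fin !ger0_norm ?sqr_ge0//; last first.
  by rewrite addr_ge0// mulr_ge0 ?sqr_ge0// mulr_ge0 ?sqr_ge0.
by rewrite (le_trans (absc_sqD_le _ _))// !absc_sqM mulrDr !mulrA.
Qed.

(** Real and imaginary part of f g^* are sums of two products of components, and
    |p q + r s| is at most the sum of the four squares. *)
Lemma cintegrable_hermitian f g : square_integrable mu f -> square_integrable
  mu g ->
  cintegrable (fun x => f x * (g x)^*).
Proof.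
move=> /square_integrableP[fr fi fy] /square_integrableP[gr gi gy].
have key (u : T -> R) : measurable_fun setT u ->
    (forall x, `|u x| <= absc (f x) ^+ 2 + absc (g x) ^+ 2) ->
    mu.-integrable setT (EFin \o u).
  move=> meu ub; apply: le_integrable (integrable_lin 1 1 fy gy) => //.
    exact/measurable_EFinP.
  move=> x _ /=; rewrite lee_fin !mul1r (le_trans (ub x))// ler_norm//.
have bound (p q r s : R) : `|p * q + r * s| <= (p ^+ 2 + r ^+ 2) + (q ^+ 2 + s
  ^+ 2).
  rewrite ler_norml; apply/andP; split; rewrite -subr_ge0.
    rewrite (_ : _ - _ = ((p + q) ^+ 2 + (r + s) ^+ 2 + p ^+ 2 + q ^+ 2 + r ^+
      2 + s ^+ 2) / 2); last by field.
    by rewrite divr_ge0// !addr_ge0// sqr_ge0.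
  rewrite (_ : _ - _ = ((p - q) ^+ 2 + (r - s) ^+ 2 + p ^+ 2 + q ^+ 2 + r ^+ 2
    + s ^+ 2) / 2); last by field.
  by rewrite divr_ge0// !addr_ge0// sqr_ge0.
split; apply: key.
- apply: (eq_measurable_fun _ _ (measurable_funD (measurable_funM fr gr)
    (measurable_funM fi gi))).
  by move=> x _ /=; case: (f x) => u v; case: (g x) => s t; simpc => /=; ring.
- move=> x; rewrite !absc_sqE; case: (f x) => u v; case: (g x) => s t;
    simpc => /=.
  exact: bound.
- apply: (eq_measurable_fun _ _ (measurable_funB (measurable_funM fi gr)
    (measurable_funM fr gi))).
  by move=> x _ /=; case: (f x) => u v; case: (g x) => s t; simpc => /=; ring.
- move=> x; rewrite !absc_sqE; case: (f x) => u v; case: (g x) => s t;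
    simpc => /=.
  rewrite [X in `|X|](_ : _ = u * (- t) + v * s); last by ring.
  by rewrite (le_trans (bound _ _ _ _))// sqrrN [t ^+ 2 + _]addrC.
Qed.

Lemma hermitian_linl (a b : C) f g h : square_integrable mu f ->
  square_integrable mu g ->
  square_integrable mu h ->
  hermitian (fun x => a * f x + b * g x) h = a * hermitian f h + b * hermitian
    g h.
Proof.
move=> sf sg sh; rewrite -(cintegrable_lin _ _ (cintegrable_hermitian sf sh)
  (cintegrable_hermitian sg sh)).2.
by congr cintegral; apply/funext => x; rewrite mulrDl !mulrA.
Qed.

Lemma hermitian_conj f g : square_integrable mu f -> square_integrable mu g ->
  hermitian g f = (hermitian f g)^*.
Proof.
move=> sf sg; have [i1 i2] := cintegrable_hermitian sf sg.
rewrite /hermitian /cintegral /=; congr (_ +i* _).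
  by apply: eq_Rintegral => x _; case: (f x) => u v; case: (g x) => s t;
    simpc => /=; ring.
rewrite -mulN1r -RintegralZl//; apply: eq_Rintegral => x _.
by case: (f x) => u v; case: (g x) => s t; simpc => /=; ring.
Qed.

Lemma hermitian_self f : hermitian f f = (\int[mu]_x (absc (f x) ^+ 2))%:C.
Proof.
rewrite /hermitian /cintegral; congr (_ +i* _).
  by apply: eq_Rintegral => x _; rewrite -absc_sq_mulJ.
rewrite (@eq_Rintegral _ _ _ _ _ (cst 0)).
  by rewrite Rintegral_cst// mul0r.
by move=> x _; rewrite -absc_sq_mulJ.
Qed.

End complex_integral.

(** * Harmonic polynomials *)

Section harmonic_polynomials.
Variables (R : realType) (m : nat).
Local Notation C := R[i].
Local Notation P := {mpoly C[m.+1]}.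
Implicit Types p q u : P.

Lemma mderiv_homog k p (i : 'I_m.+1) : p \is k.-homog ->
  p^`M(i) \is k.-1.-homog.
Proof.
move=> /dhomogP ph; apply/dhomogP => al;
  rewrite mcoeff_msupp mcoeff_deriv => al0.
have : (al + U_(i))%MM \in msupp p.
  by rewrite mcoeff_msupp; apply: contraNneq al0 => ->; rewrite mul0rn.
by move=> /ph /=; rewrite mdegD mdeg1 addn1 => <-.
Qed.

Lemma mderiv_homog0 p (i : 'I_m.+1) : p \is 0.-homog -> p^`M(i) = 0.
Proof.
move=> /dhomogP ph; apply/mpolyP => al; rewrite mcoeff_deriv mcoeff0.
rewrite memN_msupp_eq0 ?mul0rn//; apply/negP => /ph.
by rewrite /= mdegD mdeg1 addn1.
Qed.

(** Euler's identity for homogeneous polynomials, checked on monomials. *)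
Lemma euler_identity k p : p \is k.-homog -> \sum_(i < m.+1) 'X_i * p^`M(i) =
  k%:R *: p.
Proof.
move=> /dhomogP ph.
transitivity (\sum_(al <- msupp p) k%:R *: (p@_al *: 'X_[al]) : P); last first.
  by rewrite -scaler_sumr -mpolyE.
under eq_bigr => i _ do rewrite [p in p^`M(i)]mpolyE raddf_sum mulr_sumr.
rewrite exchange_big/=; apply: eq_big_seq => al /ph /= <-.
under eq_bigr => i _ do rewrite mderivZ mderivX -scalerAr -scalerAr.
rewrite -scaler_sumr scalerA mulrC -scalerA; congr (_ *: _).
rewrite mdegE natr_sum scaler_suml; apply: eq_bigr => i _.
have [->|ai] := posnP (al i); first by rewrite !scale0r.
rewrite -mpolyXD; congr (_ *: 'X_[_]); apply/mnmP => j.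
rewrite mnmDE mnmBE mnm1E; case: eqP => [<-|_]; last by rewrite subn0.
by rewrite subnKC.
Qed.

Lemma laplacianD p q : laplacian (p + q) = laplacian p + laplacian q.
Proof. by rewrite /laplacian -big_split/=; apply: eq_bigr => i _;
  rewrite !mderivD. Qed.

Lemma laplacianZ c p : laplacian (c *: p) = c *: laplacian p.
Proof. by rewrite /laplacian scaler_sumr; apply: eq_bigr => i _;
  rewrite !mderivZ. Qed.

Lemma laplacianM p q : laplacian (p * q) = laplacian p * q +
  2%:R *: (\sum_(i < m.+1) p^`M(i) * q^`M(i)) + p * laplacian q.
Proof.
rewrite /laplacian mulr_suml scaler_sumr mulr_sumr -!big_split/=.
apply: eq_bigr => i _; rewrite !mderivM !mderivD !mderivM.
by rewrite scaler_nat mulr2n !addrA.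
Qed.

Definition sqnorm_poly : P := \sum_(i < m.+1) 'X_i ^+ 2.

Lemma mderiv_sqnorm_poly (i : 'I_m.+1) : sqnorm_poly^`M(i) = 2%:R *: 'X_i.
Proof.
rewrite /sqnorm_poly raddf_sum (bigD1 i)//= big1 ?addr0 => [|j ji]; last first.
  by rewrite expr2 mderivM mderivX mnm1E (negbTE ji) !scale0r mul0r mulr0 addr0.
rewrite expr2 mderivM mderivX mnm1E eqxx scale1r (_ : (U_(i) - U_(i))%MM =
  0%MM).
  by rewrite mpolyX0 mul1r mulr1 scaler_nat mulr2n.
by apply/mnmP => j; rewrite mnmBE subnn mnm0E.
Qed.

Lemma laplacian_sqnorm_poly : laplacian sqnorm_poly = (2 * m.+1)%:R.
Proof.
rewrite /laplacian (eq_bigr (fun=> 2%:R)) => [|i _].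
  by rewrite sumr_const card_ord -mulrnA.
rewrite mderiv_sqnorm_poly mderivZ mderivX mnm1E eqxx scale1r.
rewrite (_ : (U_(i) - U_(i))%MM = 0%MM) ?mpolyX0; last first.
  by apply/mnmP => j; rewrite mnmBE subnn mnm0E.
by rewrite scaler_nat.
Qed.

Lemma sqnorm_poly_homog : sqnorm_poly \is 2.-homog.
Proof.
apply: rpred_sum => i _; rewrite -[2%N]/(1 * 2)%N; apply: dhomogMn.
by rewrite dhomogX/= mdeg1.
Qed.

(** Leibniz' rule: the gradient of |x|^2 is 2x, so the mixed term is four times
    the Euler operator applied to q. *)
Lemma laplacian_sqnormM l q : q \is l.-homog ->
  laplacian (sqnorm_poly * q) = (2 * m.+1 + 4 * l)%:R *: q + sqnorm_poly *
    laplacian q.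
Proof.
move=> ql; rewrite laplacianM laplacian_sqnorm_poly; congr (_ + _).
under eq_bigr => i _ do rewrite mderiv_sqnorm_poly -scalerAl.
rewrite -scaler_sumr (euler_identity ql) !scalerA natrD scalerDl; congr (_ + _).
  by rewrite scaler_nat mulr_natl.
by rewrite -!natrM.
Qed.

(** The constants c_j satisfy c_0 = 2n + 4l and c_(j+1) = c_j + 2n + 4(2(j+1) +
    l) with n = m + 1, so they stay positive. *)
Lemma laplacian_sqnormXM l u : u \is l.-homog -> laplacian u = 0 -> forall j,
  exists2 c : nat, (0 < c)%N &
  laplacian (sqnorm_poly ^+ j.+1 * u) = c%:R *: (sqnorm_poly ^+ j * u).
Proof.
move=> ul u0; elim=> [|j [c c0 IHj]].
  exists (2 * m.+1 + 4 * l)%N => //.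
  by rewrite expr1 expr0 mul1r (laplacian_sqnormM ul) u0 mulr0 addr0.
exists (2 * m.+1 + 4 * (2 * j.+1 + l) + c)%N => //.
rewrite exprS -mulrA (@laplacian_sqnormM (2 * j.+1 + l)) ?dhomogM//; last first.
  by apply: dhomogMn; exact: sqnorm_poly_homog.
by rewrite IHj -scalerAr mulrA -exprS -scalerDl -natrD.
Qed.

Lemma iter_laplacian_sqnormXM l u : u \is l.-homog -> laplacian u = 0 ->
  forall j,
  exists2 c : nat, (0 < c)%N & iter j (@laplacian R m) (sqnorm_poly ^+ j * u) =
    c%:R *: u.
Proof.
move=> ul u0; elim=> [|j [c c0 IHj]]; first by exists 1%N => //=;
  rewrite expr0 mul1r scale1r.
have [c' c'0 E] := laplacian_sqnormXM ul u0 j.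
exists (c' * c)%N; first by rewrite muln_gt0 c'0.
rewrite iterSr E.
have iterZ (a : C) p i : iter i (@laplacian R m) (a *: p) = a *:
  iter i (@laplacian R m) p.
  by elim: i => //= i ->; rewrite laplacianZ.
by rewrite iterZ IHj scalerA natrM.
Qed.

Lemma laplacian_homog k p : p \is k.-homog -> laplacian p \is (k - 2).-homog.
Proof.
move=> pk; apply: rpred_sum => i _; rewrite subn2; apply: mderiv_homog.
exact: mderiv_homog.
Qed.

Lemma iter_laplacian_homog k p j : p \is k.-homog -> iter j (@laplacian R m) p
  \is (k - 2 * j).-homog.
Proof.
move=> pk; elim: j => [|j IHj]; first by rewrite muln0 subn0.
by rewrite /= mulnS addnC subnDA; exact: laplacian_homog.
Qed.

Lemma iter_laplacian_eq0 k p j : p \is k.-homog -> (k < 2 * j)%N ->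
  iter j (@laplacian R m) p = 0.
Proof.
move=> pk; elim: j => // j IHj kj; rewrite iterS.
have [/IHj ->|jk] := ltnP k (2 * j).
  by rewrite /laplacian big1// => i _; rewrite !mderiv0.
have := iter_laplacian_homog j pk; move: (iter _ _ _) => q qk.
rewrite /laplacian big1// => i _; apply: mderiv_homog0.
have := mderiv_homog i qk; rewrite (_ : (k - 2 * j).-1 = 0%N)//.
by rewrite mulnS in kj; lia.
Qed.

(** Functions on the sphere that are finite sums of harmonic polynomials, one
    for each degree. The polynomials beyond n are required to be zero so that
    sums of different lengths can be added termwise. *)
Definition harmonic_sum (f : sphere R m -> C) := exists n (h : nat -> P),
  [/\ forall k, harmonic_polynomial k (h k), forall k, (n <= k)%N -> h k = 0 &
      forall x, f x = \sum_(k < n) eval_sphere (h k) x].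

Lemma harmonic_polynomial0 k : harmonic_polynomial k (0 : P).
Proof.
split; first exact: dhomog0.
by rewrite /laplacian big1// => i _; rewrite !mderiv0.
Qed.

Lemma harmonic_sum_lin (a : C) f g : harmonic_sum f -> harmonic_sum g ->
  harmonic_sum (fun x => a * f x + g x).
Proof.
move=> [n [h [hh h0 fE]]] [n' [h' [hh' h'0 gE]]].
exists (n + n')%N, (fun k => a *: h k + h' k); split.
- move=> k; have [h1 h2] := hh k; have [h1' h2'] := hh' k; split.
    by apply: dhomogD => //; exact: dhomogZ.
  by rewrite laplacianD laplacianZ h2 h2' scaler0 addr0.
- move=> k nk; rewrite h0 ?h'0 ?scaler0 ?addr0//.
    by rewrite (leq_trans _ nk)// leq_addl.
  by rewrite (leq_trans _ nk)// leq_addr.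
- have ext (N N' : nat) (e : nat -> P) x : (N <= N')%N -> (forall k,
    (N <= k)%N -> e k = 0) ->
      \sum_(k < N) eval_sphere (e k) x = \sum_(k < N') eval_sphere (e k) x.
    move=> NN' e0; rewrite (big_ord_widen _ (fun k => eval_sphere (e k) x) NN')
      big_mkcond/=.
    apply: eq_bigr => k _; case: ltnP => // Nk.
    by rewrite e0// /eval_sphere meval0.
  move=> x; rewrite fE gE (ext n (n + n')%N) ?leq_addr// (ext n' (n + n')%N)
    ?leq_addl//.
  rewrite mulr_sumr -big_split; apply: eq_bigr => k _.
  by rewrite /eval_sphere mevalD mevalZ.
Qed.

Lemma harmonic_sum_harmonic k (h : P) : harmonic_polynomial k h -> harmonic_sum
  (eval_sphere h).
Proof.
move=> hk; exists k.+1, (fun j => if j == k then h else 0); split.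
- by move=> j; case: eqP => [->//|_]; exact: harmonic_polynomial0.
- by move=> j kj; rewrite gtn_eqF.
- move=> x; rewrite (bigD1 ord_max)//= eqxx big1 ?addr0// => j jk.
  by rewrite -val_eqE/= in jk; rewrite (negbTE jk) /eval_sphere meval0.
Qed.

(** On the sphere |x|^2 = 1, which is why powers of |x|^2 can be dropped from a
    decomposition into harmonic polynomials. *)
Lemma eval_sqnorm_poly (x : sphere R m) : eval_sphere sqnorm_poly x = 1.
Proof.
rewrite /eval_sphere /sqnorm_poly raddf_sum/=.
under eq_bigr => i _ do rewrite rmorphXn/= mevalXU -rmorphXn.
rewrite -rmorph_sum/=; have /eqP := valP x; rewrite /sqnorm => ->.
by [].
Qed.

(** Induction on the order j of polyharmonicity. If Delta^(j+1) p = 0, then u =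
    Delta^j p is harmonic and Delta^j (|x|^(2j) u) = c u with c > 0, so p - c^-1
    |x|^(2j) u is annihilated by Delta^j, while |x|^(2j) u agrees with the
    harmonic polynomial u on the sphere. *)
Lemma harmonic_sum_homog j : forall k p, p \is k.-homog ->
  iter j (@laplacian R m) p = 0 -> harmonic_sum (eval_sphere p).
Proof.
elim: j => [|j IHj] k p pk.
  by move=> /= ->; apply: (@harmonic_sum_harmonic 0);
    exact: harmonic_polynomial0.
move=> pj0; pose u := iter j (@laplacian R m) p.
have ul : u \is (k - 2 * j).-homog by exact: iter_laplacian_homog.
have u0 : laplacian u = 0 by [].
have [kj|jk] := leqP (2 * j) k; last first.
  exact: IHj pk (iter_laplacian_eq0 pk jk).
have [c c0 E] := iter_laplacian_sqnormXM ul u0 j.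
pose q := p - c%:R^-1 *: (sqnorm_poly ^+ j * u).
(* c is a positive natural number and the characteristic is zero *)
have c0' : (c%:R : C) != 0 by rewrite pnatr_eq0 -lt0n.
have qk : q \is k.-homog.
  rewrite /q -scaleN1r; apply: dhomogD => //; do 2 apply: dhomogZ.
  rewrite -(subnKC kj); apply: dhomogM => //.
  by apply: dhomogMn; exact: sqnorm_poly_homog.
have iterB p1 p2 (a : C) i : iter i (@laplacian R m) (p1 - a *: p2) =
    iter i (@laplacian R m) p1 - a *: iter i (@laplacian R m) p2.
  by elim: i => //= i ->; rewrite -scaleN1r laplacianD !laplacianZ scaleN1r.
have qj : iter j (@laplacian R m) q = 0.
  by rewrite /q iterB E scalerA mulVf// scale1r subrr.
have := harmonic_sum_lin c%:R^-1 (harmonic_sum_harmonic (conj ul u0)) (IHj _ _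
  qk qj).
congr harmonic_sum; apply/funext => x.
rewrite /eval_sphere /q mevalB mevalZ mevalM rmorphXn/=.
have := eval_sqnorm_poly x; rewrite /eval_sphere => ->.
by rewrite expr1n mul1r addrC subrK.
Qed.

(** Each application of the Laplacian lowers the degree by two, so a monomial is
    annihilated by a high enough power of it. *)
Theorem harmonic_sum_poly p : harmonic_sum (eval_sphere p).
Proof.
elim/mpolyind: p => [|c al p _ _ IHp].
  by apply: (@harmonic_sum_harmonic 0); exact: harmonic_polynomial0.
have Xh : ('X_[al] : P) \is (mdeg al).-homog by rewrite dhomogX.
have X0 : iter (mdeg al).+1 (@laplacian R m) 'X_[al] = 0.
  by apply: iter_laplacian_eq0 Xh _; lia.
have := harmonic_sum_lin c (harmonic_sum_homog Xh X0) IHp.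
by congr harmonic_sum; apply/funext => x; rewrite /eval_sphere mevalD mevalZ.
Qed.

End harmonic_polynomials.

(** * Orthogonality of spherical harmonics of different degrees *)

Section sphere_polynomial_integrals.
Variables (R : realType) (m : nat).
Local Notation C := R[i].
Local Notation P := {mpoly C[m.+1]}.
Local Notation S := (sphere R m).
Local Notation sigma := (surface_measure R m).
Implicit Types p q u : P.

Definition exponents (al : 'X_{1..m.+1}) : nat -> nat := fun j => nth 0%N al j.

Lemma degree_exponents al : degree m (exponents al) = mdeg al.
Proof. by rewrite mdegE; apply: eq_bigr => i _; rewrite /exponents -mnm_nth.
Qed.

Lemma eval_sphereX al (x : S) : eval_sphere ('X_[al] : P) x =
  (monomial (exponents al) (val x))%:C.
Proof.
rewrite /eval_sphere mevalX /monomial rmorph_prod/=; apply: eq_bigr => i _.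
by rewrite -rmorphXn/= /exponents -mnm_nth.
Qed.

Lemma square_integrable_bounded (f : S -> C) (D : R) :
  measurable_fun setT (fun x => complex.Re (f x)) ->
  measurable_fun setT (fun x => complex.Im (f x)) ->
  (forall x, absc (f x) ^+ 2 <= D) -> square_integrable sigma f.
Proof.
move=> mr mi fD; apply/square_integrableP; split=> //.
apply: (@bounded_integrable _ _ _ _ _ D).
  by under eq_fun do rewrite absc_sqE; apply: measurable_funD;
    exact: measurable_funX.
by move=> x; rewrite ger0_norm ?sqr_ge0.
Qed.

Lemma square_integrable_cst (c : C) : square_integrable sigma (fun=> c).
Proof. exact: (@square_integrable_bounded _ (absc c ^+ 2)). Qed.

Lemma square_integrable_sphereX al : square_integrable sigma (eval_sphere
  ('X_[al] : P)).
Proof.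
apply: (@square_integrable_bounded _ 1).
- by under eq_fun do rewrite eval_sphereX/=; exact: measurable_monomial_sphere.
- by under eq_fun do rewrite eval_sphereX/=; exact: measurable_cst.
- move=> x; rewrite eval_sphereX absc_sqE/= expr0n addr0 -real_normK
    ?num_real//.
  by rewrite expr_le1//; exact: norm_monomial_sphere.
Qed.

Lemma square_integrable_poly p : square_integrable sigma (eval_sphere p).
Proof.
elim/mpolyind: p => [|c al p _ _ IHp].
  rewrite (_ : eval_sphere 0 = fun=> 0); first exact: square_integrable_cst.
  by apply/funext => x; rewrite /eval_sphere meval0.
rewrite (_ : eval_sphere _ = fun x => c * eval_sphere ('X_[al] : P) x + 1 *
  eval_sphere p x).
  exact: (square_integrable_lin c 1 (square_integrable_sphereX al) IHp).
by apply/funext => x; rewrite /eval_sphere mevalD mevalZ mul1r.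
Qed.

Lemma cintegrable_poly p : cintegrable sigma (eval_sphere p).
Proof.
have := cintegrable_hermitian (square_integrable_poly p) (square_integrable_cst
  1).
by congr cintegrable; apply/funext => x; rewrite rmorph1 mulr1.
Qed.

Definition poly_integral p : C := cintegral sigma (eval_sphere p).

Lemma poly_integral_lin (a b : C) p q :
  poly_integral (a *: p + b *: q) = a * poly_integral p + b * poly_integral q.
Proof.
rewrite -(cintegrable_lin a b (cintegrable_poly p) (cintegrable_poly q)).2.
by congr cintegral; apply/funext => x; rewrite /eval_sphere mevalD !mevalZ.
Qed.

Lemma poly_integralD p q : poly_integral (p + q) = poly_integral p +
  poly_integral q.
Proof.
have -> : p + q = 1 *: p + 1 *: q by rewrite !scale1r.
by rewrite poly_integral_lin (mul1r (poly_integral p)) (mul1r (poly_integral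
  q)).
Qed.

Lemma poly_integralZ a p : poly_integral (a *: p) = a * poly_integral p.
Proof.
have -> : a *: p = a *: p + 0 *: p by rewrite scale0r addr0.
by rewrite poly_integral_lin mul0r addr0.
Qed.

Lemma poly_integral0 : poly_integral 0 = 0.
Proof. by rewrite -[X in poly_integral X](scale0r 0) poly_integralZ mul0r. Qed.

Lemma poly_integral_sum (I : Type) (r : seq I) (F : I -> P) :
  poly_integral (\sum_(i <- r) F i) = \sum_(i <- r) poly_integral (F i).
Proof. exact: (big_morph poly_integral poly_integralD poly_integral0). Qed.

Lemma poly_integralX al : poly_integral 'X_[al] = (moment R m (exponents
  al))%:C.
Proof.
rewrite /poly_integral /cintegral /moment; congr (_ +i* _).
  by apply: eq_Rintegral => x _; rewrite eval_sphereX.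
rewrite (@eq_Rintegral _ _ _ _ _ (cst 0));
  first by rewrite Rintegral_cst// mul0r.
by move=> x _; rewrite eval_sphereX.
Qed.

(** The constants of [spherical_integration_by_parts] depend only on the degree,
    so the formula extends linearly from monomials to homogeneous polynomials.
    *)
Lemma poly_integration_by_parts : exists kappa : nat -> C, forall s u (i :
  'I_m.+1),
  u \is s.-homog -> poly_integral ('X_i * u) = kappa s * poly_integral u^`M(i).
Proof.
have [kappa ibp] := @spherical_integration_by_parts R m.
exists (fun s => (kappa s)%:C) => s u i /dhomogP us.
rewrite [u in 'X_i * u]mpolyE [u in u^`M(i)]mpolyE raddf_sum mulr_sumr.
rewrite !poly_integral_sum mulr_sumr; apply: eq_big_seq => al /us /= als.
rewrite mderivZ mderivX -scalerAr -mpolyXD !poly_integralZ mulrCA;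
  congr (_ * _).
rewrite !poly_integralX.
have e1 : exponents (U_(i) + al)%MM = (fun j => exponents al j + (j == i))%N.
  apply/funext => j; rewrite /exponents; have [jm|mj] := ltnP j m.+1.
    by rewrite -!(mnm_nth _ _ (Ordinal jm)) mnmDE mnm1E addnC -val_eqE eq_sym.
  by rewrite !nth_default ?size_tuple// gtn_eqF// (leq_trans (ltn_ord i)).
have e2 : exponents (al - U_(i))%MM = (fun j => exponents al j - (j == i))%N.
  apply/funext => j; rewrite /exponents; have [jm|mj] := ltnP j m.+1.
    by rewrite -!(mnm_nth _ _ (Ordinal jm)) mnmBE mnm1E -val_eqE eq_sym.
  by rewrite !nth_default ?size_tuple.
rewrite e1 e2 ibp degree_exponents als /exponents -mnm_nth.
by rewrite !rmorphM/= rmorph_nat.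
Qed.

(** Write k p as the sum of the x_i (d_i p) by Euler's identity and integrate by
    parts; the second derivatives of p add up to its Laplacian, which is zero.
    *)
Lemma euler_integral (kappa : nat -> C) :
  (forall s u (i : 'I_m.+1),
  u \is s.-homog -> poly_integral ('X_i * u) = kappa s * poly_integral u^`M(i))
    ->
  forall k l p q, harmonic_polynomial k p -> q \is l.-homog ->
  k%:R * poly_integral (p * q) = kappa (k + l).-1 *
    poly_integral (\sum_(i < m.+1) p^`M(i) * q^`M(i)).
Proof.
move=> ibp k l p q [pk p0] ql.
rewrite -poly_integralZ scalerAl -(euler_identity pk) mulr_suml
  poly_integral_sum.
have [k0|k0] := posnP k.
  have dp0 (i : 'I_m.+1) : p^`M(i) = 0 by apply: mderiv_homog0; move: pk;
    rewrite k0.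
  rewrite !big1 ?poly_integral0 ?mulr0// => i _; first by rewrite dp0 mul0r.
  by rewrite dp0 mulr0 mul0r poly_integral0.
transitivity (\sum_(i < m.+1) kappa (k + l).-1 * poly_integral
  ((p^`M(i) * q)^`M(i))).
  apply: eq_bigr => i _; rewrite -mulrA; apply: ibp.
  rewrite (_ : (k + l).-1 = k.-1 + l)%N; last by rewrite -[in LHS](prednK k0).
  by apply: dhomogM => //; exact: mderiv_homog.
rewrite -mulr_sumr -poly_integral_sum; congr (_ * poly_integral _).
under eq_bigr do rewrite mderivM.
by rewrite big_split/= -mulr_suml -/(laplacian p) p0 mul0r add0r.
Qed.

(** The right-hand side of [euler_integral] is symmetric in p and q, hence k and
    l times the integral of p q are equal. *)
Theorem harmonic_orthogonal k l p q : k != l ->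
  harmonic_polynomial k p -> harmonic_polynomial l q -> poly_integral (p * q) =
    0.
Proof.
move=> kl hp hq; have [kappa ibp] := poly_integration_by_parts.
have E1 := euler_integral ibp hp hq.1.
have E2 := euler_integral ibp hq hp.1.
have : (k%:R - l%:R) * poly_integral (p * q) = 0.
  rewrite mulrBl E1 [p * q]mulrC E2 addnC.
  apply/eqP; rewrite subr_eq0; apply/eqP; congr (_ * poly_integral _).
  by apply: eq_bigr => i _; rewrite mulrC.
move/eqP; rewrite mulf_eq0 => /orP[|/eqP//].
by rewrite subr_eq0 eqr_nat (negbTE kl).
Qed.

(** The conjugate of a polynomial function of real variables is the polynomial
    function with conjugate coefficients, and the Laplacian has real
    coefficients. *)
Lemma conj_harmonic k q : harmonic_polynomial k q -> exists2 q' : P,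
  harmonic_polynomial k q' & forall x, eval_sphere q' x = (eval_sphere q x)^*.
Proof.
move=> [qk q0]; exists (map_mpoly (@conjc R) q); last first.
  move=> x; elim/mpolyind: {qk q0} q => [|c al q _ _ IHq].
    by rewrite rmorph0 /eval_sphere !meval0 conjc0.
  rewrite rmorphD/= map_mpolyZ map_mpolyX.
  have lin a (u v : P) : eval_sphere (a *: u + v) x = a * eval_sphere u x +
    eval_sphere v x.
    by rewrite /eval_sphere mevalD mevalZ.
  by rewrite !lin rmorphD/= rmorphM/= IHq eval_sphereX conjc_real.
split.
  apply/dhomogP => al;
    rewrite mcoeff_msupp mcoeff_map_mpoly conjc_eq0 -mcoeff_msupp.
  by move/dhomogP : qk => /[apply].
have dmap (u : P) (i : 'I_m.+1) : (map_mpoly (@conjc R) u)^`M(i) = map_mpoly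
  (@conjc R) u^`M(i).
  apply/mpolyP => al; rewrite mcoeff_deriv !mcoeff_map_mpoly/= mcoeff_deriv.
  by rewrite rmorphMn.
transitivity (map_mpoly (@conjc R) (laplacian q)); last by rewrite q0 rmorph0.
by rewrite /laplacian rmorph_sum/=; apply: eq_bigr => i _; rewrite !dmap.
Qed.

Theorem spherical_harmonics_orthogonal k l (f g : S -> C) : k != l ->
  spherical_harmonics k f -> spherical_harmonics l g -> inner2 f g = 0.
Proof.
move=> kl [p hp <-] [q hq <-]; have [q' hq' E] := conj_harmonic hq.
rewrite /inner2 (_ : cintegral _ _ = poly_integral (p * q')).
  by rewrite (harmonic_orthogonal kl hp hq') mulr0.
congr cintegral; apply/funext => x.
by rewrite [RHS]mevalM [X in _ = _ * X]E.
Qed.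

End sphere_polynomial_integrals.

(** * Density of the polynomials in the square-integrable functions *)

Section step_approximation.
Variable R : realType.

(** On [0, 1] these polynomials in t approximate the indicator of [0, 1/2]. With
    u = t^(2n) / n the base is 1 - u and the exponent 4^n, and 4^n u = (2t)^(2n)
    / n tends to 0 if t <= 1/2 and to infinity if t > 1/2; the division by n
    makes the limit 1 also at t = 1/2. *)
Definition step_approx (n : nat) (t : R) : R := (1 - t ^+ (2 * n) / n%:R) ^+
  (4 ^ n).

Lemma bernoulli_ineq (u : R) k : -1 <= u -> 1 + k%:R * u <= (1 + u) ^+ k.
Proof.
move=> u1; elim: k => [|k IHk]; first by rewrite mul0r addr0 expr0.
rewrite exprS (@le_trans _ _ ((1 + u) * (1 + k%:R * u)))//; last first.
  by rewrite ler_wpM2l// -lerBlDl sub0r.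
rewrite -subr_ge0 -[k.+1%:R]natr1 (_ : _ - _ = k%:R * u ^+ 2); last by ring.
by rewrite mulr_ge0// sqr_ge0.
Qed.

Lemma step_approx01 n t : 0 <= t <= 1 -> 0 <= step_approx n.+1 t <= 1.
Proof.
move=> /andP[t0 t1].
have u1 : t ^+ (2 * n.+1) / n.+1%:R <= 1.
  rewrite ler_pdivrMr ?ltr0n// mul1r (@le_trans _ _ 1)// ?exprn_ile1//.
  by rewrite ler1n.
have u0 : 0 <= t ^+ (2 * n.+1) / n.+1%:R by rewrite divr_ge0// exprn_ge0.
rewrite exprn_ge0 ?subr_ge0//= exprn_ile1 ?subr_ge0//.
by rewrite gerBl.
Qed.

(** Two consequences of Bernoulli's inequality: (1 - u)^N >= 1 - N u, and (1 -
    u)^N (1 + N u) <= (1 - u^2)^N <= 1. *)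
Lemma step_approx_cvg t : 0 <= t <= 1 ->
  (fun n => step_approx n.+1 t) @ \oo --> ((t <= 2^-1)%R%:R : R).
Proof.
move=> t01; have /andP[t0 t1] := t01.
have bounds n := step_approx01 n t01.
pose u n := t ^+ (2 * n.+1) / n.+1%:R.
have u0 n : 0 <= u n by rewrite divr_ge0// exprn_ge0.
have u1 n : u n <= 1.
  rewrite ler_pdivrMr ?ltr0n// mul1r (@le_trans _ _ 1)// ?exprn_ile1//.
  by rewrite ler1n.
(* N u in closed form *)
have kuE n : (4 ^ n.+1)%:R * u n = ((2 * t) ^+ n.+1) ^+ 2 / n.+1%:R.
  rewrite /u mulrA; congr (_ / _).
  rewrite natrX -[in RHS]exprM [(n.+1 * 2)%N]mulnC exprMn [in X in _ =
    X * _]exprM.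
  by congr (_ ^+ _ * _); rewrite -natrX.
have [t2|t2] := leP t 2^-1.
  have h n : 1 - harmonic n <= step_approx n.+1 t.
    rewrite (@le_trans _ _ (1 + (4 ^ n.+1)%:R * - u n))//.
      rewrite lerD2l mulrN lerN2 kuE /harmonic/= -[leRHS]mul1r ler_wpM2r//.
      rewrite -exprM exprn_ile1 ?mulr_ge0//.
      by rewrite mulrC -ler_pdivlMr// mul1r.
    by apply: bernoulli_ineq; rewrite lerN2.
  apply: (@squeeze_cvgr _ _ _ _ (fun n => 1 - harmonic n) (cst 1)).
  - by apply: nearW => n; rewrite h/=; have /andP[] := bounds n.
  - rewrite -[X in _ --> X]subr0; apply: cvgB; first exact: cvg_cst.
    exact: cvg_harmonic.
  - exact: cvg_cst.
pose del := 2 * t - 1.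
have d0 : 0 < del by rewrite subr_gt0 mulrC -ltr_pdivrMr// mul1r.
apply: (@squeeze_cvgr _ _ _ _ (cst 0) (fun n => (del ^+ 2)^-1 * harmonic n)).
- apply: nearW => n /=; have /andP[-> _] := bounds n; rewrite /=.
  (* Bernoulli again, for the powers of 2t = 1 + del *)
  have a1 : n.+1%:R * del <= (2 * t) ^+ n.+1.
    have := @bernoulli_ineq del n.+1; rewrite (_ : 1 + del = 2 * t);
      last by rewrite /del; ring.
    have dm1 : -1 <= del by rewrite (le_trans _ (ltW d0))// oppr_le0.
    by move=> /(_ dm1); apply: le_trans; rewrite lerDr.
  have a2 : n.+1%:R * del ^+ 2 <= (4 ^ n.+1)%:R * u n.
    rewrite kuE ler_pdivlMr ?ltr0n//.
    rewrite [leLHS](_ : _ = (n.+1%:R * del) ^+ 2); last by ring.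
    by rewrite lerXn2r ?nnegrE// ?mulr_ge0// ?exprn_ge0 ?mulr_ge0// ltW.
  have a3 : step_approx n.+1 t * (1 + (4 ^ n.+1)%:R * u n) <= 1.
    rewrite (@le_trans _ _ (step_approx n.+1 t * (1 + u n) ^+ (4 ^ n.+1)))//.
      rewrite ler_wpM2l//; first by have /andP[] := bounds n.
      by apply: bernoulli_ineq; rewrite (le_trans _ (u0 n))// oppr_le0.
    rewrite /step_approx -/(u n) -exprMn -subr_sqr expr1n exprn_ile1//.
      by rewrite subr_ge0 expr_le1.
    by rewrite gerBl sqr_ge0.
  have nd0 : 0 < n.+1%:R * del ^+ 2 by rewrite mulr_gt0 ?ltr0n// exprn_gt0.
  rewrite /harmonic/= -invfM mulrC -[leRHS]mul1r ler_pdivlMr//.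
  rewrite (le_trans _ a3)// ler_wpM2l//; first by have /andP[] := bounds n.
  by rewrite (le_trans a2)// lerDr.
- exact: cvg_cst.
- rewrite -[X in _ --> X](mulr0 (del ^+ 2)^-1).
  by apply: cvgM; [exact: cvg_cst|exact: cvg_harmonic].
Qed.

End step_approximation.

Section density.
Variables (R : realType) (m : nat).
Local Notation C := R[i].
Local Notation P := {mpoly C[m.+1]}.
Local Notation S := (sphere R m).
Local Notation sigma := (surface_measure R m).
Local Notation sqint := (square_integrable sigma).

Definition L2sq (f : S -> C) : R := \int[sigma]_x (absc (f x) ^+ 2).

Lemma L2sq_ge0 f : 0 <= L2sq f.
Proof. by apply: Rintegral_ge0 => x _; exact: sqr_ge0. Qed.

Lemma sqintD f g : sqint f -> sqint g -> sqint (fun x => f x + g x).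
Proof.
move=> sf sg; have := square_integrable_lin 1 1 sf sg.
by congr square_integrable; apply/funext => x; rewrite !mul1r.
Qed.

Lemma sqintB f g : sqint f -> sqint g -> sqint (fun x => f x - g x).
Proof.
move=> sf sg; have := square_integrable_lin 1 (-1) sf sg.
by congr square_integrable; apply/funext => x; rewrite mul1r mulN1r.
Qed.

Lemma sqintZ c f : sqint f -> sqint (fun x => c * f x).
Proof.
move=> sf; have := square_integrable_lin c 0 sf sf.
by congr square_integrable; apply/funext => x; rewrite mul0r addr0.
Qed.

Lemma L2sqD_le f g : sqint f -> sqint g -> L2sq (fun x => f x + g x) <=
  2 * (L2sq f + L2sq g).
Proof.
move=> sf sg; have /square_integrableP[_ _ fgy] := sqintD sf sg.
have /square_integrableP[_ _ fy] := sf; have /square_integrableP[_ _ gy] := sg.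
rewrite mulrDr -(Rintegral_lin 2 2 fy gy); apply: le_Rintegral => //.
  exact: integrable_lin.
by move=> x _; rewrite -mulrDr; exact: absc_sqD_le.
Qed.

Lemma L2sqZ c f : sqint f -> L2sq (fun x => c * f x) = absc c ^+ 2 * L2sq f.
Proof.
move=> /square_integrableP[_ _ fy]; rewrite /L2sq -RintegralZl//.
by apply: eq_Rintegral => x _; rewrite absc_sqM.
Qed.

(** Membership in the closure of the polynomials in the square-integrable
    functions. *)
Definition approximable f := sqint f /\
  forall e, 0 < e -> exists p : P, L2sq (fun x => f x - eval_sphere p x) < e.

Lemma approximable_poly p : approximable (eval_sphere p).
Proof.
split=> [|e e0]; first exact: square_integrable_poly.
exists p; rewrite /L2sq (@eq_Rintegral _ _ _ _ _ (cst 0)).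
  by rewrite Rintegral_cst// mul0r.
by move=> x _; rewrite subrr absc_sqE expr0n addr0.
Qed.

Lemma approximable_closed f : sqint f ->
  (forall e, 0 < e -> exists2 g, approximable g & L2sq (fun x => f x - g x) <
    e) ->
  approximable f.
Proof.
move=> sf fg; split=> // e e0.
have e4 : 0 < e / 4 by rewrite divr_gt0.
have [g [sg gp] fge] := fg _ e4; have [p gpe] := gp _ e4.
exists p; rewrite (_ : (fun x => _) = fun x => (f x - g x) + (g x - eval_sphere
  p x)); last first.
  by apply/funext => x; rewrite addrA subrK.
have := L2sqD_le (sqintB sf sg) (sqintB sg (square_integrable_poly p)).
move: (L2sq _) (L2sq _) (L2sq _) fge gpe => A B D AB DB /le_lt_trans; apply.
by lra.
Qed.

Lemma approximable_lin c f g : approximable f -> approximable g ->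
  approximable (fun x => c * f x + g x).
Proof.
move=> [sf fp] [sg gp]; split; first exact/sqintD/sg/sqintZ.
move=> e e0; pose k := absc c ^+ 2 + 1.
have k0 : 0 < k by rewrite ltr_wpDl ?sqr_ge0.
have e1 : 0 < e / (4 * k) by rewrite divr_gt0// mulr_gt0.
have e2 : 0 < e / 4 by rewrite divr_gt0.
have [p fpe] := fp _ e1; have [q gqe] := gp _ e2.
exists (c *: p + q).
rewrite (_ : (fun x => _) = fun x => c * (f x - eval_sphere p x) + (g x -
  eval_sphere q x)); last first.
  by apply/funext => x; rewrite /eval_sphere mevalD mevalZ; ring.
have sp := sqintB sf (square_integrable_poly p).
have sq := sqintB sg (square_integrable_poly q).
have := L2sqD_le (sqintZ c sp) sq; rewrite (L2sqZ c sp).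
have : absc c ^+ 2 * L2sq (fun x => f x - eval_sphere p x) <= k * L2sq (fun x
  => f x - eval_sphere p x).
  by rewrite ler_wpM2r ?L2sq_ge0// lerDl.
have : k * L2sq (fun x => f x - eval_sphere p x) < e / 4.
  rewrite mulrC -ltr_pdivlMr// (lt_le_trans fpe)//.
  by rewrite invfM mulrA.
move: gqe; move: (L2sq _) (L2sq _) (L2sq _) => A B D.
move: (k * B) (absc c ^+ 2 * B) => kB cB; clear => h1 h2 h3 h4.
by lra.
Qed.

Lemma approximable_ext f g : f =1 g -> approximable f -> approximable g.
Proof. by move=> /funext ->. Qed.

Lemma square_integrable_real (u : S -> R) : measurable_fun setT u ->
  sigma.-integrable setT (EFin \o (fun x => u x ^+ 2)) -> sqint (fun x =>
    (u x)%:C).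
Proof.
move=> mu iu; apply/square_integrableP; split => //=.
by under eq_fun do rewrite absc_sqE/= expr0n addr0.
Qed.

(** Dominated convergence: the squares of the differences are at most 4 G^2. *)
Lemma approximable_limit (u : nat -> S -> R) (v G : S -> R) :
  measurable_fun setT v -> (forall n, measurable_fun setT (u n)) ->
  sigma.-integrable setT (EFin \o (fun x => G x ^+ 2)) ->
  (forall n x, `|u n x| <= G x) ->
  (forall x, u ^~ x @ \oo --> v x) ->
  (forall n, approximable (fun x => (u n x)%:C)) ->
  approximable (fun x => (v x)%:C).
Proof.
move=> mv mun iG uG uv appu.
have vG x : `|v x| <= G x.
  have uvx : (fun n => `|u n x|) @ \oo --> `|v x| by apply: cvg_norm; exact: uv.
  rewrite -(cvg_lim _ uvx)//; apply: limr_le; first by apply/cvg_ex;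
    exists `|v x|.
  by apply: nearW => n; exact: uG.
have G0 x : 0 <= G x by exact: le_trans (vG x).
have sv : sqint (fun x => (v x)%:C).
  apply: square_integrable_real => //; apply: le_integrable iG => //.
    by apply/measurable_EFinP; exact: measurable_funX.
  move=> x _ /=; rewrite lee_fin !ger0_norm ?sqr_ge0//.
  by rewrite -[v x ^+ 2]real_normK ?num_real// lerXn2r ?nnegrE.
apply: approximable_closed => // e e0.
pose F n x := ((v x - u n x) ^+ 2)%:E.
have mF n : measurable_fun setT (F n).
  by apply/measurable_EFinP; apply: measurable_funX; exact: measurable_funB.
have iG4 : sigma.-integrable setT (fun x => 4%:E * (G x ^+ 2)%:E)%E by exact:
  integrableZl.
have FG n x : (`|F n x| <= 4%:E * (G x ^+ 2)%:E)%E.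
  rewrite -EFinM /F abse_EFin lee_fin ger0_norm ?sqr_ge0// -[_ ^+ 2]real_normK
    ?num_real//.
  rewrite (_ : 4 * G x ^+ 2 = (G x + G x) ^+ 2); last by ring.
  rewrite lerXn2r ?nnegrE ?addr_ge0//.
  by rewrite (le_trans (ler_normB _ _))// lerD.
have F0 x : F ^~ x @ \oo --> 0%E.
  apply: cvg_EFin; first by apply: nearW.
  rewrite [X in X @ _ --> _](_ : _ = fun n => (v x - u n x) * (v x - u n x));
    last first.
    by apply/funext => n; rewrite /= expr2.
  have d0 : (fun n => v x - u n x) @ \oo --> 0.
    rewrite -[X in _ --> X](subrr (v x)); apply: cvgB => //; exact: cvg_cst.
  by rewrite -[X in _ --> X](mulr0 0); exact: cvgM.
have [_ _] := @dominated_convergence _ _ _ sigma setT measurableT F (cst 0%E) _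
  mF
  (@measurable_cst _ _ _ _ _ _) (aeW _ (fun x _ => F0 x)) iG4 (aeW _ (fun x n _
    => FG n x)).
rewrite integral0 => /fine_cvgP[_ /cvgrPdist_lt /(_ _ e0)[N _ /(_ N (leqnn
  N))]].
rewrite /= sub0r normrN => He.
exists (fun x => (u N x)%:C) => //.
apply: le_lt_trans (ler_norm _) _; apply: le_lt_trans He.
rewrite le_eqVlt; apply/orP; left; apply/eqP; congr `|fine _|.
by apply: eq_integral => x _; rewrite absc_sqE/= subr0 expr0n addr0.
Qed.

End density.

Section polynomial_density.
Variables (R : realType) (m : nat).
Local Notation C := R[i].
Local Notation P := {mpoly C[m.+1]}.
Local Notation S := (sphere R m).
Local Notation sigma := (surface_measure R m).
Local Notation sqint := (square_integrable sigma).
Local Notation approximable := (@approximable R m).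

(** The trace on the sphere of a product of rays; these sets form a pi-system
    that generates the Borel sets, and their indicators are limits of products
    of one-variable polynomials. *)
Definition box (b : 'I_m.+1 -> R) : set S := [set x | forall i, tnth (val x) i
  <= b i].

Definition boxes : set (set S) := [set A | exists b, A = box b].

Lemma boxes_setI : setI_closed boxes.
Proof.
move=> _ _ [b ->] [b' ->]; exists (fun i => Num.min (b i) (b' i)).
apply/seteqP; split=> x /=.
  by move=> [xb xb'] i; rewrite le_min xb xb'.
by move=> xb; split=> i; have := xb i; rewrite le_min => /andP[].
Qed.

Lemma norm_coord_sphere (x : S) i : `|tnth (val x) i| <= 1.
Proof. by apply: norm_le_sqn; rewrite ?sqn_sphere. Qed.

Lemma measurable_coord (i : 'I_m.+1) : measurable_fun setT (fun x : S =>
  tnth (val x) i).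
Proof.
apply: (@measurableT_comp _ _ _ _ _ _ (fun y : m.+1.-tuple R => tnth y i)).
  exact: measurable_tnth.
exact: measurable_sphere_val.
Qed.

Lemma measurable_box b : measurable (box b).
Proof.
rewrite (_ : box b = \bigcap_i ((fun x : S => tnth (val x) i) @^-1` `]-oo,
  b i])).
  apply: fin_bigcap_measurable => // i _.
  by rewrite -[X in measurable X]setTI; apply: measurable_coord.
by apply/seteqP; split=> [x xb i _|x xb i]; [rewrite /= in_itv/=; exact: xb|
  have := xb i I; rewrite /= in_itv/=].
Qed.

(** It suffices that the coordinates are measurable for the sigma-algebra
    generated by the boxes. The preimage of ]r, +oo[ under x_i is the complement
    of a box, the bound 1 imposing nothing on the other coordinates. *)
Lemma sphere_measurableE : (measurable : set (set S)) = <<s boxes >>.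
Proof.
apply/seteqP; split; last first.
  apply: smallest_sub; first exact: sigma_algebra_measurable.
  by move=> _ [b ->]; exact: measurable_box.
pose T := g_sigma_algebraType boxes.
have mval : measurable_fun [set: T] (val : S -> m.+1.-tuple R).
  apply/measurable_fun_tnthP => i.
  apply: (measurability (@RGenOInfty.G R)); first exact: RGenOInfty.measurableE.
  move=> _ [_ [r ->] <-]; rewrite setTI.
  rewrite (_ : _ @^-1` _ = ~` box (fun j => if j == i then r else 1)).
    by apply: (@measurableC _ T); apply: sub_sigma_algebra; eexists;
      reflexivity.
  apply/seteqP; split => x /=; rewrite in_itv/= andbT.
    by move=> rx /(_ i); rewrite eqxx leNgt rx.
  move=> xb; rewrite ltNge; apply/negP => xr; apply: xb => j.
  case: eqP => [->//|_]; exact: le_trans (ler_norm _) (norm_coord_sphere _ _).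
by move=> _ [B mB <-]; exact: mval.
Qed.

(** The polynomial [step_approx n] in the affine function of x_i that sends b to
    1/2 and maps [-1, 1] into [0, 1]. *)
Let lin_approx (n : nat) (b : R) (i : 'I_m.+1) : P :=
  (1 - (n%:R^-1)%:C *: (((2^-1)%:C)%:MP + ((2 * (1 + `|b|))^-1)%:C *:
    ('X_i - (b%:C)%:MP)) ^+ (2 * n)) ^+ (4 ^ n).

Let arg (b t : R) := 2^-1 + (2 * (1 + `|b|))^-1 * (t - b).

Let eval_lin_approx n b i x :
  eval_sphere (lin_approx n b i) x = (step_approx n (arg b (tnth (val x)
    i)))%:C.
Proof.
rewrite /eval_sphere /lin_approx rmorphXn/= mevalB meval1 mevalZ rmorphXn/=.
rewrite mevalD mevalC mevalZ mevalB mevalXU mevalC.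
by rewrite /step_approx /arg !(rmorphXn, rmorphB, rmorphM, rmorphD, rmorph1)/=
  [X in _ = (1 - X) ^+ _]mulrC.
Qed.

Let arg01 b t : `|t| <= 1 -> 0 <= arg b t <= 1.
Proof.
move=> t1; rewrite /arg invfM; set L := 1 + `|b|.
have L0 : 0 < L by rewrite ltr_pwDl.
have tb : `|L^-1 * (t - b)| <= 1.
  rewrite normrM ger0_norm ?invr_ge0 ?(ltW L0)// mulrC ler_pdivrMr// mul1r.
  by rewrite (le_trans (ler_normB _ _))// lerD2r.
have := tb; rewrite ler_norml -mulrA; move: (L^-1 * (t - b)) => z /andP[z0 z1].
by apply/andP; split; lra.
Qed.

Let arg_le b t : (arg b t <= 2^-1) = (t <= b).
Proof.
have L0 : 0 < 2 * (1 + `|b|) by rewrite mulr_gt0// ltr_pwDl.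
by rewrite /arg gerDl pmulr_rle0 ?invr_gt0// subr_le0.
Qed.

(** The products of the one-coordinate approximations take values in [0, 1] and
    converge pointwise to the indicator. *)
Lemma approximable_box b : approximable (fun x => (\1_(box b) x : R)%:C).
Proof.
pose u n (x : S) := \prod_i step_approx n.+1 (arg (b i) (tnth (val x) i)).
have uE n : (fun x => (u n x)%:C) = eval_sphere (\prod_i lin_approx n.+1 (b i)
  i).
  apply/funext => x; rewrite /eval_sphere rmorph_prod /u rmorph_prod.
  by apply: eq_bigr => i _; exact/esym/eval_lin_approx.
have app n : approximable (fun x => (u n x)%:C) by rewrite uE;
  exact: approximable_poly.
apply: (@approximable_limit _ _ u _ (cst 1)) => //.
- exact: measurable_indic (measurable_box b).
- by move=> n; have [[]] := app n.
- rewrite (_ : _ \o _ = EFin \o cst 1); last by apply/funext => x /=;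
    rewrite expr1n.
  exact: finite_measure_integrable_cst.
- move=> n x; rewrite /u normr_prod.
  rewrite [leRHS](_ : _ = \prod_(i < m.+1) 1); last by rewrite big1.
  apply: ler_prod => i _; rewrite normr_ge0/=.
  have /andP[s0 s1] := step_approx01 n (arg01 (b i) (norm_coord_sphere x i)).
  by rewrite ger0_norm.
- move=> x.
  have -> : \1_(box b) x = \prod_i (arg (b i) (tnth (val x) i) <= 2^-1)%R%:R :>
    R.
    rewrite indicE; case: (boolP (x \in box b)) => [/[!inE] xb|].
      by rewrite big1// => i _; rewrite arg_le xb.
    rewrite notin_setE => /existsNP[i /negP xi].
    by rewrite (bigD1 i)//= arg_le (negbTE xi) mul0r.
  have cst i := step_approx_cvg (arg01 (b i) (norm_coord_sphere x i)).
  have H (r : seq 'I_m.+1) : (fun n => \prod_(i <- r) step_approx n.+1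
    (arg (b i) (tnth (val x) i)))
      @ \oo --> \prod_(i <- r) ((arg (b i) (tnth (val x) i) <= 2^-1)%R%:R : R).
    elim: r => [|i r IHr].
      by rewrite big_nil; under eq_fun do rewrite big_nil; exact: cvg_cst.
    rewrite big_cons; under eq_fun do rewrite big_cons.
    by apply: cvgM.
  exact: H.
Qed.

(** The sets with approximable indicator form a Dynkin system containing the
    boxes. *)
Lemma approximable_measurable A : measurable A -> approximable (fun x =>
  (\1_A x : R)%:C).
Proof.
have app1 : approximable (fun=> 1%:C).
  apply: approximable_ext (approximable_poly 1) => x.
  by rewrite /eval_sphere meval1.
rewrite sphere_measurableE.
apply: (@dynkin_induction _ S boxes (fun A => approximable (fun x => (\1_A x :
  R)%:C))).
- exact: sphere_measurableE.
- exact: boxes_setI.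
- by apply: approximable_ext app1 => x; rewrite indicT.
- by move=> _ [b ->]; exact: approximable_box.
- move=> B _ appB; apply: approximable_ext (approximable_lin (-1) appB app1) =>
    x.
  rewrite !indicE in_setC; case: (x \in B) => /=.
    by rewrite mulr1 addNr.
  by rewrite mulr0 add0r.
- move=> F mF tF appF.
  (* by disjointness at most one of the sets contains x *)
  have sumE x : (exists k0, forall n, \sum_(k < n) \1_(F k) x = (k0 < n)%N%:R
    :> R /\
        \1_(\bigcup_k F k) x = 1 :> R) \/
      (forall n, \sum_(k < n) \1_(F k) x = 0 :> R) /\ \1_(\bigcup_k F k) x =
        0 :> R.
    have [[k0 _ Fx]|Fx] := pselect ((\bigcup_k F k) x); [left|right].
      exists k0 => n; split; last by rewrite indicE mem_set//; exists k0.
      have E k : \1_(F k) x = (k == k0)%:R :> R.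
        rewrite indicE; have [->|kk0] := eqVneq k k0; first by rewrite mem_set.
        rewrite memNset// => Fkx; move/eqP: kk0; apply.
        by apply: (tF k k0) => //; exists x.
      under eq_bigr do rewrite E.
      have [k0n|nk0] := ltnP k0 n.
        by rewrite (bigD1 (Ordinal k0n))//= eqxx big1 ?addr0// => i;
          rewrite -val_eqE/= => /negbTE ->.
      by rewrite big1// => i _; rewrite ltn_eqF// (leq_trans (ltn_ord i)).
    split; last by rewrite indicE memNset.
    by move=> n; rewrite big1// => k _; rewrite indicE memNset// => Fkx;
      apply: Fx; exists k.
  apply: (@approximable_limit _ _ (fun n x => \sum_(k < n) \1_(F k) x) _
    (cst 1)).
  + by apply: measurable_indic; exact: bigcupT_measurable.
  + by move=> n; apply: measurable_sum => k; exact: measurable_indic.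
  + rewrite (_ : _ \o _ = EFin \o cst 1); last by apply/funext => x /=;
      rewrite expr1n.
    exact: finite_measure_integrable_cst.
  + move=> n x; have [[k0 /(_ n)[-> _]]|[/(_ n) -> _]] := sumE x;
      last by rewrite normr0.
    by rewrite normr_nat lern1 leq_b1.
  + move=> x; have [[k0 h]|[h ->]] := sumE x; last first.
      by under eq_fun do rewrite h; exact: cvg_cst.
    have [_ ->] := h 0%N.
    apply: cvg_near_cst; exists k0.+1 => // n /= k0n.
    by have [-> _] := h n; rewrite k0n.
  + elim=> [|n IHn].
      apply: approximable_ext (approximable_poly 0) => x.
      by rewrite big_ord0 /eval_sphere meval0.
    apply: approximable_ext (approximable_lin 1 (appF n) IHn) => x.
    by rewrite big_ord_recr/= rmorphD/= mul1r addrC.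
Qed.

Import HBNNSimple.

Lemma approximable_nnsfun (h : {nnsfun S >-> R}) : approximable (fun x =>
  (h x)%:C).
Proof.
have H n (c : nat -> R) (A : nat -> set S) : (forall k, measurable (A k)) ->
    approximable (fun x => (\sum_(k < n) c k * \1_(A k) x : R)%:C).
  move=> mA; elim: n => [|n IHn].
    apply: approximable_ext (approximable_poly 0) => x.
    by rewrite big_ord0 /eval_sphere meval0.
  apply: approximable_ext (approximable_lin (c n)%:C (approximable_measurable
    (mA n)) IHn) => x.
  by rewrite big_ord_recr/= rmorphD/= rmorphM/= addrC.
pose s : seq R := finmap.enum_fset (fset_set (range h)).
apply: approximable_ext (H (size s) (fun k => s`_k) (fun k =>
  h @^-1` [set s`_k]) _) => [x|k].
  by congr (_%:C); rewrite [RHS]fimfunEord; apply: eq_bigr.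
exact: measurable_sfunP.
Qed.

Lemma approximable_nneg (u : S -> R) : measurable_fun setT u -> (forall x, 0 <=
  u x) ->
  sigma.-integrable setT (EFin \o (fun x => u x ^+ 2)) -> approximable (fun x
    => (u x)%:C).
Proof.
move=> mu u0 iu.
have mE : measurable_fun setT (EFin \o u) by exact/measurable_EFinP.
pose h := nnsfun_approx measurableT mE.
have ch x : (fun n => h n x) @ \oo --> u x.
  have : EFin \o (fun n => h n x) @ \oo --> (u x)%:E.
    by apply: (@cvg_nnsfun_approx _ _ _ _ measurableT _ mE) => // y _;
      rewrite lee_fin.
  by move=> /fine_cvgP[].
apply: (@approximable_limit _ _ (fun n x => h n x) u u) => //.
- move=> n x; rewrite ger0_norm//.
  rewrite -(cvg_lim _ (ch x))//; apply: nondecreasing_cvgn_le; last first.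
    by apply/cvg_ex; exists (u x); exact: ch.
  by move=> a b ab; have /lefP := nd_nnsfun_approx measurableT mE ab; exact.
- by move=> n; exact: approximable_nnsfun.
Qed.

(** Simple functions increase to a nonnegative function and are dominated by it;
    a complex function is a combination of four nonnegative ones. *)
Theorem polynomial_density f : sqint f -> approximable f.
Proof.
move=> /square_integrableP[fr fi fy].
have real (u : S -> R) : measurable_fun setT u -> (forall x, u x ^+ 2 <=
  absc (f x) ^+ 2) ->
    approximable (fun x => (u x)%:C).
  move=> mu uf.
  have part (v : S -> R) : measurable_fun setT v -> (forall x, 0 <= v x <=
    `|u x|) ->
      approximable (fun x => (v x)%:C).
    move=> mv vu; have v0 x : 0 <= v x by have /andP[] := vu x.
    apply: approximable_nneg => //; apply: le_integrable fy => //.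
      by apply/measurable_EFinP; exact: measurable_funX.
    move=> x _ /=; rewrite lee_fin !ger0_norm ?sqr_ge0//.
    rewrite (le_trans _ (uf x))// -[u x ^+ 2]real_normK ?num_real//.
    by rewrite lerXn2r ?nnegrE//; have /andP[] := vu x.
  have pos : approximable (fun x => (Num.max (u x) 0)%:C).
    apply: part; first exact: measurable_maxr.
    by move=> x; rewrite le_max lexx orbT ge_max ler_norm normr_ge0.
  have neg : approximable (fun x => (Num.max (- u x) 0)%:C).
    apply: part; first by apply: measurable_maxr => //; exact: measurableT_comp.
    by move=> x; rewrite le_max lexx orbT ge_max -normrN ler_norm normr_ge0.
  apply: approximable_ext (approximable_lin (-1) neg pos) => x.
  rewrite mulN1r -rmorphN -rmorphD; congr (_%:C).
  have [ux|ux] := leP (u x) 0; first by rewrite max_l ?oppr_ge0// opprK addr0.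
  by rewrite max_r ?oppr_le0 ?ltW// oppr0 add0r.
have re := real _ fr; have im := real _ fi.
apply: approximable_ext (approximable_lin 'i (im _) (re _)) => x.
- by rewrite [RHS]complexE addrC.
- by rewrite absc_sqE lerDr sqr_ge0.
- by rewrite absc_sqE lerDl sqr_ge0.
Qed.

End polynomial_density.

(** * Parseval's identity for spherical harmonics *)

Section parseval.
Variables (R : realType) (m : nat).
Local Notation C := R[i].
Local Notation P := {mpoly C[m.+1]}.
Local Notation S := (sphere R m).
Local Notation sigma := (surface_measure R m).
Local Notation omega := (total_area R m).
Local Notation sqint := (square_integrable sigma).
Local Notation inner := (@inner2 R m).
Local Notation L2sq := (@L2sq R m).
Implicit Types f g h : S -> C.

Lemma sqint_sum (I : Type) (r : seq I) (F : I -> S -> C) :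
  (forall i, sqint (F i)) -> sqint (fun x => \sum_(i <- r) F i x).
Proof.
move=> sF; elim: r => [|i r IHr].
  rewrite (_ : (fun x => _) = fun=> 0); first exact: square_integrable_cst.
  by apply/funext => x; rewrite big_nil.
rewrite (_ : (fun x => _) = fun x => F i x + \sum_(j <- r) F j x);
  first exact: sqintD.
by apply/funext => x; rewrite big_cons.
Qed.

Lemma inner_linl (a b : C) f g h : sqint f -> sqint g -> sqint h ->
  inner (fun x => a * f x + b * g x) h = a * inner f h + b * inner g h.
Proof.
move=> sf sg sh; have := hermitian_linl a b sf sg sh.
rewrite /inner2 /hermitian => ->; rewrite mulrDr.
by congr (_ + _); rewrite mulrCA.
Qed.

Lemma inner_conj f g : sqint f -> sqint g -> inner g f = (inner f g)^*.
Proof.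
move=> sf sg; have := hermitian_conj sf sg; rewrite /inner2 /hermitian => ->.
by rewrite rmorphM; congr (_ * _); exact/esym/conjc_real.
Qed.

Definition mean_sq f : R := omega^-1 * L2sq f.

Lemma inner_self f : inner f f = (mean_sq f)%:C.
Proof.
by have := hermitian_self sigma f; rewrite /inner2 /hermitian => ->;
  rewrite /mean_sq rmorphM.
Qed.

Lemma mean_sq_ge0 f : 0 <= mean_sq f.
Proof.
by rewrite mulr_ge0 ?L2sq_ge0// invr_ge0 ltW// total_area_gt0.
Qed.

Lemma innerBl f g h : sqint f -> sqint g -> sqint h ->
  inner (fun x => f x - g x) h = inner f h - inner g h.
Proof.
move=> sf sg sh.
have -> : (fun x => f x - g x) = (fun x => 1 * f x + (-1) * g x).
  by apply/funext => x; rewrite mul1r mulN1r.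
by rewrite (inner_linl 1 (-1) sf sg sh) mul1r mulN1r.
Qed.

Lemma innerZl (a : C) f h : sqint f -> sqint h ->
  inner (fun x => a * f x) h = a * inner f h.
Proof.
move=> sf sh.
have -> : (fun x => a * f x) = (fun x => a * f x + 0 * f x).
  by apply/funext => x; rewrite mul0r addr0.
by rewrite (inner_linl a 0 sf sf sh) mul0r addr0.
Qed.

Lemma inner_suml (I : Type) (r : seq I) (c : I -> C) (F : I -> S -> C) h :
  (forall i, sqint (F i)) -> sqint h ->
  inner (fun x => \sum_(i <- r) c i * F i x) h = \sum_(i <- r) c i * inner
    (F i) h.
Proof.
move=> sF sh; elim: r => [|i r IHr].
  rewrite big_nil (_ : (fun x => _) = fun x => 0 * (cst 0 : S -> C) x).
    by rewrite innerZl ?mul0r//; exact: square_integrable_cst.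
  by apply/funext => x; rewrite big_nil mul0r.
have -> : (fun x => \sum_(j <- i :: r) c j * F j x) =
    (fun x => c i * F i x + 1 * \sum_(j <- r) c j * F j x).
  by apply/funext => x; rewrite big_cons mul1r.
have sr : sqint (fun x => \sum_(j <- r) c j * F j x).
  by apply: sqint_sum => j; exact: sqintZ.
by rewrite (inner_linl (c i) 1 (sF i) sr sh) mul1r IHr big_cons.
Qed.

Lemma innerBr f g h : sqint f -> sqint g -> sqint h ->
  inner h (fun x => f x - g x) = inner h f - inner h g.
Proof.
move=> sf sg sh; rewrite (inner_conj (sqintB sf sg) sh) (innerBl sf sg sh).
by rewrite (inner_conj sf sh) (inner_conj sg sh); exact: rmorphB.
Qed.

Lemma inner_sumr (I : Type) (r : seq I) (c : I -> C) (F : I -> S -> C) h :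
  (forall i, sqint (F i)) -> sqint h ->
  inner h (fun x => \sum_(i <- r) c i * F i x) = \sum_(i <- r) (c i)^* * inner
    h (F i).
Proof.
move=> sF sh.
have sS : sqint (fun x => \sum_(i <- r) c i * F i x).
  by apply: sqint_sum => j; exact: sqintZ.
rewrite (inner_conj sS sh) inner_suml// rmorph_sum; apply: eq_bigr => i _.
by rewrite rmorphM (inner_conj (sF i) sh).
Qed.

Section orthonormal.
Variables (I : finType) (e : I -> S -> C).
Hypothesis se : forall i, sqint (e i).
Hypothesis orth : forall i j, inner (e i) (e j) = (i == j)%:R.

Lemma inner_lincomb c j : inner (fun x => \sum_i c i * e i x) (e j) = c j.
Proof.
rewrite inner_suml// (bigD1 j)//= orth eqxx mulr1 big1 ?addr0// => i ij.
by rewrite orth (negbTE ij) mulr0.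
Qed.

(** Completing the square in the coefficients c. *)
Lemma pythagoras f c : sqint f ->
  mean_sq (fun x => f x - \sum_i c i * e i x) = mean_sq f - \sum_i absc (inner
    f (e i)) ^+ 2
    + \sum_i absc (inner f (e i) - c i) ^+ 2.
Proof.
move=> sf; apply: (@complexI R).
have ss : sqint (fun x => \sum_i c i * e i x).
  by apply: sqint_sum => j; exact: sqintZ.
rewrite -inner_self (innerBl sf ss (sqintB sf ss)) (innerBr sf ss sf) (innerBr
  sf ss ss).
rewrite inner_self !inner_sumr// inner_suml//.
rewrite rmorphD rmorphB !rmorph_sum/= -!addrA; congr (_ + _).
rewrite opprB -!sumrN -!big_split/=.
apply: eq_bigr => i _;
  rewrite inner_lincomb (inner_conj sf (se i)) !absc_sq_mulJ.
by move: (inner f (e i)) (c i) => u v; rewrite rmorphB/=; ring.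
Qed.

(** The error of the best approximation is at most that of any other. *)
Lemma bessel_dist f c : sqint f ->
  mean_sq f - \sum_i absc (inner f (e i)) ^+ 2 <= mean_sq (fun x =>
    f x - \sum_i c i * e i x).
Proof. by move=> sf; rewrite pythagoras// lerDl sumr_ge0// => i _;
  exact: sqr_ge0. Qed.

Lemma bessel f : sqint f -> \sum_i absc (inner f (e i)) ^+ 2 <= mean_sq f.
Proof.
move=> sf; rewrite -subr_ge0.
have := pythagoras (fun i => inner f (e i)) sf.
rewrite [X in _ + X]big1 ?addr0 => [<-|i _]; first exact: mean_sq_ge0.
by rewrite subrr absc_sqE expr0n addr0.
Qed.

End orthonormal.

Variables (d : nat -> nat) (Y : forall k, 'I_(d k) -> S -> C).
Arguments Y : clear implicits.
Hypothesis hY : forall k, orthonormal_basis k (Y k).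

Lemma sqint_harmonics k h : spherical_harmonics k h -> sqint h.
Proof. by move=> [p _ <-]; exact: square_integrable_poly. Qed.

Lemma sqint_basis k j : sqint (Y k j).
Proof. by apply: (@sqint_harmonics k); have [+ _ _] := hY k; exact. Qed.

(** Indices of the basis elements of degree less than n, gathered in one finite
    type so that orthonormality covers different degrees as well. *)
Definition trunc_index n := {k : 'I_n & 'I_(d k)}.
Definition trunc_basis n (i : trunc_index n) := Y _ (tagged i).

Lemma trunc_basis_orthonormal n (i j : trunc_index n) :
  inner (trunc_basis i) (trunc_basis j) = (i == j)%:R.
Proof.
case: i j => [k i] [l j]; rewrite /trunc_basis /=.
have [kl|kl] := eqVneq k l.
  case: l / kl j => j; have [_ -> _] := hY k.
  by rewrite eq_Tagged.
have [Yk _ _] := hY k; have [Yl _ _] := hY l.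
rewrite (@spherical_harmonics_orthogonal _ _ k l)//.
by rewrite -tag_eqE /tag_eq/= (negbTE kl).
Qed.

(** A polynomial is a sum of harmonics on the sphere, and each harmonic is a
    combination of the basis of its degree. *)
Lemma poly_in_span (p : P) : exists n (c : trunc_index n -> C),
  eval_sphere p = fun x => \sum_i c i * trunc_basis i x.
Proof.
have [n [h [hh h0 pE]]] := harmonic_sum_poly p.
have H k : exists c : 'I_(d k) -> C,
    eval_sphere (h k) = fun x => \sum_(j < d k) c j * Y k j x.
  by have [_ _ +] := hY k; apply; exists (h k) => //; exact: hh.
pose c k := sval (cid (H k)).
have cE k : eval_sphere (h k) = fun x => \sum_(j < d k) c k j * Y k j x :=
  svalP (cid (H k)).
exists n, (fun i => c _ (tagged i)).
apply/funext => x; rewrite pE.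
rewrite -(@sig_big_dep _ _ _ 'I_n (fun k => 'I_(d k)) xpredT (fun _ => xpredT)
  (fun k j => c k j * Y k j x)).
by apply: eq_bigr => k _; rewrite cE.
Qed.

(** The partial sums are at most the squared norm by Bessel's inequality.
    Conversely a polynomial within eps of f lies in the span of the harmonics of
    degree less than some n, and the orthogonal projection onto that span is at
    least as close to f. *)
Theorem parseval f : sqint f ->
  (\sum_(0 <= k <oo) (\sum_(j < d k) absc (inner f (Y k j)) ^+ 2)%:E =
    (mean_sq f)%:E)%E.
Proof.
move=> sf.
have truncE n : \sum_(0 <= k < n) \sum_(j < d k) absc (inner f (Y k j)) ^+ 2 =
    \sum_(i : trunc_index n) absc (inner f (trunc_basis i)) ^+ 2.
  rewrite -(@sig_big_dep _ _ _ 'I_n (fun k => 'I_(d k)) xpredT (fun _ => xpredT)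
    (fun k j => absc (inner f (Y k j)) ^+ 2)).
  by rewrite big_mkord.
have sst n (i : trunc_index n) : sqint (trunc_basis i) by exact: sqint_basis.
apply/eqP; rewrite eq_le; apply/andP; split.
  apply: lime_le; first by apply: is_cvg_nneseries => k _ _;
    rewrite lee_fin sumr_ge0// => j _; exact: sqr_ge0.
  apply: nearW => n; rewrite sumEFin lee_fin truncE.
  by apply: bessel => //; exact: trunc_basis_orthonormal.
apply/lee_addgt0Pr => eps eps0.
have o0 : 0 < omega := @total_area_gt0 R m.
have [_ /(_ (omega * eps))[|p pe]] := polynomial_density sf;
  first by rewrite mulr_gt0.
have [n [c pE]] := poly_in_span p.
apply: (@le_trans _ _ ((\sum_(0 <= k < n) (\sum_(j < d k) absc (inner f
  (Y k j)) ^+ 2)%:E) + eps%:E)%E); last first.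
  rewrite leeD2r//; apply: nneseries_lim_ge => k _ _.
  by rewrite lee_fin sumr_ge0// => j _; exact: sqr_ge0.
rewrite sumEFin truncE -EFinD lee_fin -lerBlDl.
rewrite (le_trans (bessel_dist (sst n) (@trunc_basis_orthonormal n) c sf))//.
rewrite /mean_sq mulrC ler_pdivrMr// mulrC ltW//.
by move: pe; rewrite pE.
Qed.

End parseval.

(** * The multiplier identity *)

Section ae_invariance.
Import HBNNSimple.

(** The integral of a nonnegative function, measurable or not, is a supremum
    over the simple functions below it, and setting such a function to zero on a
    null set does not change its integral. This matters for y |-> norm2 (M (K^y)
    - K^y), which is only known to coincide almost everywhere with a measurable
    function. *)
Lemma ae_eq_integral_ge0 d (T : measurableType d) (R : realType)
    (mu : {measure set T -> \bar R}) (f g : T -> \bar R) :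
  (forall x, 0 <= f x)%E -> (forall x, 0 <= g x)%E ->
  {ae mu, forall x, f x = g x} -> (\int[mu]_x f x = \int[mu]_x g x)%E.
Proof.
move=> f0 g0 fg.
suff le (u v : T -> \bar R) : (forall x, 0 <= u x)%E -> (forall x, 0 <= v x)%E
  ->
    {ae mu, forall x, u x = v x} -> (\int[mu]_x u x <= \int[mu]_x v x)%E.
  apply/eqP; rewrite eq_le !le//.
  by apply: filterS fg => x ->.
move=> u0 v0 [N [mN N0 subN]].
rewrite (ge0_integralTE _ u0) (ge0_integralTE _ v0).
apply: ge_ereal_sup => _ [h /= hu <-]; apply: ereal_sup_ubound.
exists (proj_nnsfun h (measurableC mN)) => /=.
  move=> x; rewrite /= /mindic indicE; have [xN|xN] := boolP (x \in ~` N).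
    rewrite mulr1 (le_trans (hu x))//.
    suff -> : u x = v x by [].
    move: xN; rewrite inE => xN; apply: contrapT => uv; apply: xN.
    exact: (subN x uv).
  by rewrite mulr0.
rewrite -!integralT_nnsfun; apply: ge0_ae_eq_integral => //.
- exact/measurable_EFinP.
- exact/measurable_EFinP.
- by move=> x _; rewrite lee_fin; exact: fun_ge0.
- by move=> x _; rewrite lee_fin; exact: fun_ge0.
exists N; split => // x /= /not_implyP[_ hx]; apply: contrapT => xN; apply: hx.
by rewrite /mindic indicE mem_set// mulr1.
Qed.

End ae_invariance.

Section multiplier.
Variables (R : realType) (m : nat).
Local Notation C := R[i].
Local Notation S := (sphere R m).
Local Notation sigma := (surface_measure R m).
Local Notation omega := (total_area R m).
Local Notation sqint := (square_integrable sigma).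
Local Notation inner := (@inner2 R m).
Variables (d : nat -> nat) (Y : forall k, 'I_(d k) -> S -> C).
Arguments Y : clear implicits.
Hypothesis hY : forall k, orthonormal_basis k (Y k).

Let orthY k i j : inner (Y k i) (Y k j) = (i == j)%:R.
Proof. by have [_ + _] := hY k; exact. Qed.

Let sY k j : sqint (Y k j) := sqint_basis hY j.

(** Existence is by the explicit formula; uniqueness follows by reading off the
    coefficients of a competing projection on the basis. *)
Lemma harmonic_projE k f : sqint f ->
  harmonic_proj k f = fun x => \sum_(j < d k) inner f (Y k j) * Y k j x.
Proof.
move=> sf; have [Yk _ span] := hY k.
set g := fun x => _.
have sg : sqint g by apply: sqint_sum => j; exact: sqintZ.
have gk : spherical_harmonics k g.
  have YP j : exists2 p, harmonic_polynomial k p & eval_sphere p = Y k j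
    by exact: Yk.
  pose p j := s2val (cid2 (YP j)).
  have hp j : harmonic_polynomial k (p j) := s2valP (cid2 (YP j)).
  have pY j : eval_sphere (p j) = Y k j := s2valP' (cid2 (YP j)).
  exists (\sum_(j < d k) inner f (Y k j) *: p j).
    split; first by apply: rpred_sum => j _; apply: rpredZ; exact: (hp j).1.
    elim/big_ind : _ => [|u v u0 v0|j _].
    - exact: (harmonic_polynomial0 R m k).2.
    - by rewrite laplacianD u0 v0 addr0.
    - by rewrite laplacianZ (hp j).2 scaler0.
  apply/funext => x; rewrite /eval_sphere raddf_sum; apply: eq_bigr => j _ /=.
  by rewrite mevalZ -pY.
apply: xget_unique.
- split=> // h /span[c ->].
  have sfg : sqint (f \- g) by exact: sqintB.
  rewrite inner_sumr// big1// => j _.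
  have -> : inner (f \- g) (Y k j) = inner f (Y k j) - inner g (Y k j)
    by exact: innerBl.
  by rewrite /g inner_lincomb// subrr mulr0.
- move=> w [wk wf]; have [c wE] := span _ wk.
  have sw : sqint w by exact: sqint_harmonics wk.
  rewrite wE; apply/funext => x; apply: eq_bigr => j _; congr (_ * _).
  apply/esym/eqP; rewrite -subr_eq0; apply/eqP.
  rewrite -[RHS](wf _ (Yk j)).
  have -> : inner (f \- w) (Y k j) = inner f (Y k j) - inner w (Y k j)
    by exact: innerBl.
  by rewrite wE inner_lincomb.
Qed.

Lemma multiplier_coef (M : (S -> C) -> S -> C) (eta : nat -> C) f k j :
  multiplier_operator M eta -> sqint f ->
  inner (M f) (Y k j) = eta k * inner f (Y k j).
Proof.
move=> hM sf; have sMf := multiplier_L2 hM sf.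
have := multiplier_proj hM k sf; rewrite !harmonic_projE// => E.
have := congr1 (fun u => inner u (Y k j)) E => /=.
rewrite inner_lincomb// => ->.
rewrite innerZl ?inner_lincomb//.
by apply: sqint_sum => i; exact: sqintZ.
Qed.

End multiplier.

Section cmeasurable.
Context d (T : measurableType d) (R : realType).
Local Notation C := R[i].
Implicit Types f g : T -> C.

(** Measurability of the components, the form used by [square_integrable]. *)
Definition cmeasurable f :=
  measurable_fun setT (fun x => complex.Re (f x)) /\
  measurable_fun setT (fun x => complex.Im (f x)).

Lemma cmeasurable_cst (c : C) : cmeasurable (fun=> c).
Proof. by split; exact: measurable_cst. Qed.

Lemma cmeasurableD f g : cmeasurable f -> cmeasurable g -> cmeasurable (fun x
  => f x + g x).
Proof.
move=> [f1 f2] [g1 g2]; split.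
  apply: (eq_measurable_fun _ _ (measurable_funD f1 g1)) => x _ /=.
  by case: (f x) => ? ?; case: (g x).
apply: (eq_measurable_fun _ _ (measurable_funD f2 g2)) => x _ /=.
by case: (f x) => ? ?; case: (g x).
Qed.

Lemma cmeasurableM f g : cmeasurable f -> cmeasurable g -> cmeasurable (fun x
  => f x * g x).
Proof.
move=> [f1 f2] [g1 g2]; split.
  apply: (eq_measurable_fun _ _ (measurable_funB (measurable_funM f1 g1)
    (measurable_funM f2 g2))) => x _ /=.
  by case: (f x) => ? ?; case: (g x).
apply: (eq_measurable_fun _ _ (measurable_funD (measurable_funM f1 g2)
  (measurable_funM f2 g1))) => x _ /=.
by case: (f x) => ? ?; case: (g x).
Qed.

Lemma cmeasurableJ f : cmeasurable f -> cmeasurable (fun x => (f x)^*).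
Proof.
move=> [f1 f2]; split.
  by apply: (eq_measurable_fun _ _ f1) => x _; case: (f x).
apply: (eq_measurable_fun _ _ (measurable_funN f2)) => x _ /=.
by case: (f x).
Qed.

Lemma cmeasurableB f g : cmeasurable f -> cmeasurable g -> cmeasurable (fun x
  => f x - g x).
Proof.
move=> mf mg; have := cmeasurableD mf (cmeasurableM (cmeasurable_cst (-1)) mg).
by congr cmeasurable; apply/funext => x; rewrite mulN1r.
Qed.

Lemma cmeasurable_sum (I : Type) (r : seq I) (F : I -> T -> C) :
  (forall i, cmeasurable (F i)) -> cmeasurable (fun x => \sum_(i <- r) F i x).
Proof.
move=> mF; elim: r => [|i r IHr].
  rewrite (_ : (fun x => _) = fun=> 0); first exact: cmeasurable_cst.
  by apply/funext => x; rewrite big_nil.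
rewrite (_ : (fun x => _) = fun x => F i x + \sum_(j <- r) F j x);
  first exact: cmeasurableD.
by apply/funext => x; rewrite big_cons.
Qed.

Lemma measurable_absc_sq f : cmeasurable f -> measurable_fun setT (fun x =>
  absc (f x) ^+ 2).
Proof.
move=> [f1 f2]; under eq_fun do rewrite absc_sqE.
by apply: measurable_funD; exact: measurable_funX.
Qed.

End cmeasurable.

Section expansion.
Variables (R : realType) (m : nat).
Local Notation C := R[i].
Local Notation S := (sphere R m).
Local Notation sigma := (surface_measure R m).
Local Notation omega := (total_area R m).
Local Notation sqint := (square_integrable sigma).
Local Notation inner := (@inner2 R m).
Local Notation mean_sq := (@mean_sq R m).
Variables (d : nat -> nat) (Y : forall k, 'I_(d k) -> S -> C).
Arguments Y : clear implicits.
Hypothesis hY : forall k, orthonormal_basis k (Y k).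
Variables (a : forall k, 'I_(d k) -> C).
Arguments a : clear implicits.
Variable (K : S * S -> C).
Hypothesis hK : square_integrable (sigma \x sigma)%E K.
Hypothesis hKa : L2_expansion Y a K.

Let sY k j : sqint (Y k j) := sqint_basis hY j.

Let mY k j : cmeasurable (Y k j).
Proof. by have [? ? _] := sY j; split. Qed.

Let cK : cmeasurable K.
Proof. by have [? ? _] := hK; split. Qed.

Let mpartial n : cmeasurable (partial_expansion Y a n).
Proof.
apply: cmeasurable_sum => k; apply: cmeasurable_sum => j.
have mfst : cmeasurable (fun z : S * S => Y k j z.1).
  have [f1 f2] := mY j; split.
    exact: (measurableT_comp f1 measurable_fst).
  exact: (measurableT_comp f2 measurable_fst).
have msnd : cmeasurable (fun z : S * S => Y k j z.2).
  have [f1 f2] := mY j; split.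
    exact: (measurableT_comp f1 measurable_snd).
  exact: (measurableT_comp f2 measurable_snd).
apply: cmeasurableM; last exact: cmeasurableJ.
by apply: cmeasurableM => //; exact: cmeasurable_cst.
Qed.

Let sqdev n (z : S * S) : \bar R := (absc (K z - partial_expansion Y a n z) ^+
  2)%:E.

Let msqdev n : measurable_fun setT (sqdev n).
Proof. by apply/measurable_EFinP/measurable_absc_sq; exact: cmeasurableB. Qed.

Let sqdev_ge0 n z : (0 <= sqdev n z)%E.
Proof. by rewrite lee_fin sqr_ge0. Qed.

Let slice_sqdev n (y : S) : \bar R := (\int[sigma]_x sqdev n (x, y))%E.

Lemma ae_slice_square_integrable : {ae sigma, forall y, sqint (fun x =>
  K (x, y))}.
Proof.
have /square_integrableP[k1 k2 k3] := hK.
have := ae_integrable2 k3; apply: filterS => y iy; apply/square_integrableP;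
  split => //.
- exact: (measurableT_comp k1 (measurable_pair2 y)).
- exact: (measurableT_comp k2 (measurable_pair2 y)).
Qed.

(** By Tonelli the squared distances in x between K(., y) and its partial sums
    have integrals over y that tend to zero, so Fatou's lemma makes their lower
    limit vanish almost everywhere. *)
Lemma ae_slice_sqdev : {ae sigma, forall y, limn_einf (slice_sqdev ^~ y) = 0%E}.
Proof.
have ms n : measurable_fun setT (slice_sqdev n).
  exact: (@measurable_fun_fubini_tonelli_G _ _ _ _ _ sigma (sqdev n) (msqdev n)
    (sqdev_ge0 n)).
have s0 n y : (0 <= slice_sqdev n y)%E by apply: integral_ge0.
have fat := fatou sigma measurableT ms (fun n x _ => s0 n x).
have E n : (\int[sigma]_y slice_sqdev n y = \int[sigma \x sigma]_z sqdev n z)%E.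
  exact/esym/(@fubini_tonelli2 _ _ _ _ _ sigma sigma (sqdev n) (msqdev n)
    (sqdev_ge0 n)).
have l0 : limn_einf (fun n => \int[sigma]_y slice_sqdev n y)%E = 0%E.
  under eq_fun do rewrite E.
  rewrite is_cvg_limn_einfE; first exact/cvg_lim.
  by apply/cvg_ex; exists 0%E.
have ml : measurable_fun setT (fun y => limn_einf (slice_sqdev ^~ y)).
  apply: (emeasurable_fun_cvg (fun n y => einfs (slice_sqdev ^~ y) n)) =>
    [n|y _].
    exact: measurable_fun_einfs.
  by rewrite limn_einf_lim; exact: is_cvg_einfs.
have le0 y : (0 <= limn_einf (slice_sqdev ^~ y))%E.
  rewrite limn_einf_lim; apply: lime_ge; first exact: is_cvg_einfs.
  apply: nearW => n; apply: le_ereal_inf_tmp => _ [k /= nk <-]; exact: s0.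
have I0 : (\int[sigma]_y `|limn_einf (slice_sqdev ^~ y)| = 0)%E.
  apply/eqP; rewrite eq_le integral_ge0// andbT.
  rewrite (eq_integral (fun y => limn_einf (slice_sqdev ^~ y)));
    first by rewrite -l0.
  by move=> y _; rewrite gee0_abs.
have /(ae_eq_integral_abs _ measurableT ml) := I0.
by apply: filterS => y /(_ I).
Qed.

(** As soon as n > k, the partial sum has the asserted coefficient, so by
    Bessel's inequality the error of the coefficient is bounded by the distance
    of the slice to the n-th partial sum. That distance comes arbitrarily close
    to zero. *)
Lemma slice_coef y k j : sqint (fun x => K (x, y)) ->
  limn_einf (slice_sqdev ^~ y) = 0%E ->
  inner (fun x => K (x, y)) (Y k j) = a k j * (Y k j y)^*.
Proof.
move=> sK l0; apply/eqP; rewrite -subr_eq0.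
set del := _ - _.
suff : (omega * absc del ^+ 2)%:E = 0%E.
  move=> [] /eqP; rewrite mulf_eq0 gt_eqF ?total_area_gt0//= absc_sqE.
  case: del => u v /=; rewrite paddr_eq0 ?sqr_ge0// !sqrf_eq0 => /andP[/eqP ->
    /eqP ->].
  by [].
apply/eqP; rewrite eq_le; apply/andP; split; last first.
  by rewrite lee_fin mulr_ge0 ?sqr_ge0// ltW// total_area_gt0.
have key n : (k < n)%N -> ((omega * absc del ^+ 2)%:E <= slice_sqdev n y)%E.
  move=> kn.
  pose c (i : trunc_index d n) : C := a _ (tagged i) * (Y _ (tagged i) y)^*.
  have sst (i : trunc_index d n) : sqint (trunc_basis Y i) by exact: sY.
  have pE : (fun x => partial_expansion Y a n (x, y)) = fun x => \sum_i c i *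
    trunc_basis Y i x.
    apply/funext => x; rewrite /partial_expansion.
    rewrite (@sig_big_dep _ _ _ 'I_n (fun k => 'I_(d k)) xpredT (fun _ =>
      xpredT)
      (fun k j => a k j * Y k j x * (Y k j y)^*)).
    by apply: eq_bigr => i _; rewrite /c /trunc_basis mulrAC.
  have sp : sqint (fun x => partial_expansion Y a n (x, y)).
    by rewrite pE; apply: sqint_sum => i; exact: sqintZ.
  pose g x := K (x, y) - partial_expansion Y a n (x, y).
  have sg : sqint g by exact: sqintB.
  have delE : del = inner g (Y k j).
    rewrite /g innerBl// pE.
    by rewrite -[Y k j in X in _ = _ - X]/(trunc_basis Y (Tagged (fun i :
      'I_n => 'I_(d i)) (j : 'I_(d (Ordinal kn)))))
     inner_lincomb//; exact: trunc_basis_orthonormal.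
  have : absc del ^+ 2 <= mean_sq g.
    have [_ oY _] := hY k.
    apply: le_trans (bessel (@sY k) oY sg).
    by rewrite delE (bigD1 j)//= lerDl sumr_ge0// => i _; exact: sqr_ge0.
  have /square_integrableP[_ _ ig] := sg.
  have -> : slice_sqdev n y = (L2sq g)%:E by rewrite /L2sq /Rintegral fineK//
    (integrable_fin_num measurableT ig).
  by rewrite /mean_sq ler_pdivlMl ?total_area_gt0// lee_fin.
rewrite -l0 limn_einf_lim.
apply: lime_ge; first exact: is_cvg_einfs.
exists k.+1 => // n /= kn; apply: le_ereal_inf_tmp => _ [i /= ni <-].
by apply: key; exact: leq_trans ni.
Qed.

Variables (M : (S -> C) -> S -> C) (eta : nat -> C).
Hypothesis hM : multiplier_operator M eta.

(** The value of the squared norm of M (K^y) - K^y predicted by Parseval's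
    identity. *)
Let spectral y : \bar R := (\sum_(0 <= k <oo)
   (absc (eta k - 1) ^+ 2 * \sum_(j < d k) (absc (a k j) ^+ 2 * absc (Y k j y)
     ^+ 2))%:E)%E.

Lemma norm2_sq f : sqint f -> (norm2 f ^+ 2 = (mean_sq f)%:E)%E.
Proof.
move=> /square_integrableP[_ _ sf]; rewrite /norm2.
rewrite -(fineK (integrable_fin_num measurableT sf)) -EFinM poweR_EFin
  -EFin_expe.
by rewrite powR12_sqrt ?sqr_sqrtr// ?mean_sq_ge0.
Qed.

(** The coefficient of M (K^y) - K^y on Y_(k,j) is (eta_k - 1) a_(k,j) times the
    conjugate of Y_(k,j)(y). *)
Lemma slice_defect y : sqint (fun x => K (x, y)) ->
  limn_einf (slice_sqdev ^~ y) = 0%E ->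
  (norm2 (fun x => M (fun x' => K (x', y)) x - K (x, y))%R ^+ 2 = spectral y)%E.
Proof.
move=> sK l0; have sMK := multiplier_L2 hM sK.
have sg := sqintB sMK sK.
rewrite norm2_sq// -(parseval hY sg); apply: eq_eseriesr => k _; congr EFin.
rewrite mulr_sumr; apply: eq_bigr => j _.
rewrite innerBl// (multiplier_coef hY j hM sK) slice_coef//.
rewrite -[X in _ - X]mul1r -mulrBl !absc_sqM.
by congr (_ * (_ * _)); case: (Y k j y) => u v; rewrite !absc_sqE/= sqrrN.
Qed.

(** Monotone convergence, the basis functions having normalised norm one. *)
Lemma integral_spectral : (\int[sigma]_y spectral y = omega%:E * \sum_(0 <=
  k <oo)
     (absc (eta k - 1) ^+ 2 * \sum_(j < d k) absc (a k j) ^+ 2)%R%:E)%E.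
Proof.
have term_ge0 (I : finType) (u v : I -> R) (w : R) :
  (0 <= (w ^+ 2 * \sum_j (u j ^+ 2 * v j ^+ 2))%:E)%E.
  by rewrite lee_fin mulr_ge0 ?sqr_ge0// sumr_ge0// => j _;
    rewrite mulr_ge0 ?sqr_ge0.
have mYsq k j : measurable_fun setT (fun y => absc (Y k j y) ^+ 2).
  exact: measurable_absc_sq.
rewrite integral_nneseries//; last first.
  move=> k; apply/measurable_EFinP; apply: measurable_funM => //.
  by apply: measurable_sum => j; apply: measurable_funM.
rewrite -nneseriesZl; last first.
  by move=> k _; rewrite lee_fin mulr_ge0 ?sqr_ge0// sumr_ge0// => j _;
    exact: sqr_ge0.
apply: eq_eseriesr => k _.
have iY j : (\int[sigma]_y (absc (Y k j y) ^+ 2)%:E = omega%:E)%E.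
  have /square_integrableP[_ _ iYj] := sY j.
  rewrite -(fineK (integrable_fin_num measurableT iYj)); congr EFin.
  have [_ /(_ j j) oY _] := hY k; move: oY; rewrite eqxx inner_self => -[] E1.
  move: E1; rewrite /mean_sq /L2sq /Rintegral => /(congr1 ( *%R omega)).
  by rewrite mulrA divff ?mul1r ?mulr1// gt_eqF// total_area_gt0.
under eq_integral => y _ do rewrite EFinM.
rewrite ge0_integralZl_EFin ?sqr_ge0//; last 2 first.
- by move=> y _; rewrite lee_fin sumr_ge0// => j _; rewrite mulr_ge0 ?sqr_ge0.
- by apply/measurable_EFinP; apply: measurable_sum => j; apply: measurable_funM.
under eq_integral => y _ do rewrite -sumEFin.
rewrite ge0_integral_sum//; last 2 first.
- by move=> j; apply/measurable_EFinP; apply: measurable_funM.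
- by move=> j y _; rewrite lee_fin mulr_ge0 ?sqr_ge0.
rewrite (eq_bigr (fun j => (absc (a k j) ^+ 2 * omega)%:E)) => [|j _];
  last first.
  under eq_integral => y _ do rewrite EFinM.
  rewrite ge0_integralZl_EFin ?sqr_ge0//.
  - by rewrite iY EFinM.
  - by move=> y _; rewrite lee_fin sqr_ge0.
  - exact/measurable_EFinP.
by rewrite sumEFin -!EFinM -mulr_suml mulrA mulrC.
Qed.

End expansion.

Theorem theorem2p2 (R : realType) (m : nat) (hm : (2 <= m)%N)
    (d : nat -> nat) (Y : forall k, 'I_(d k) -> sphere R m -> R[i])
    (hY : forall k, orthonormal_basis k (Y k))
    (M : (sphere R m -> R[i]) -> sphere R m -> R[i]) (eta : nat -> R[i])
    (hM : multiplier_operator M eta)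
    (K : sphere R m * sphere R m -> R[i])
    (hK : square_integrable (surface_measure R m \x surface_measure R m)%E K)
    (a : forall k, 'I_(d k) -> R[i]) (hKa : L2_expansion Y a K) :
  (\sum_(0 <= k <oo)
     (absc (eta k - 1) ^+ 2 * \sum_(j < d k) absc (a k j) ^+ 2)%R%:E =
   ((total_area R m)^-1)%:E *
     \int[surface_measure R m]_y
       norm2 (fun x => M (fun x' => K (x', y)) x - K (x, y))%R ^+ 2)%E.
Proof.
have o0 := @total_area_gt0 R m.
rewrite [X in (_ * X)%E](_ : _ = (\int[surface_measure R m]_y \sum_(0 <= k <oo)
   (absc (eta k - 1) ^+ 2 * \sum_(j < d k) (absc (a k j) ^+ 2 * absc (Y k j y)
     ^+ 2))%:E)%E).
  by rewrite (integral_spectral hY) muleA -EFinM mulVf ?mul1e// gt_eqF.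
apply: ae_eq_integral_ge0.
- by move=> y; rewrite expe2 mule_ge0// poweR_ge0.
- move=> y; apply: nneseries_ge0 => k _ _.
  by rewrite lee_fin mulr_ge0 ?sqr_ge0// sumr_ge0// => j _;
    rewrite mulr_ge0 ?sqr_ge0.
have := ae_slice_square_integrable hK; have := ae_slice_sqdev hY hK hKa.
apply: filterS2 => y l0 sK.
exact: slice_defect sK l0.
Qed.
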